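(* Let $\mathcal{X}$ be any projective variety of dimension $d$ over $\mathbb{F}_q$ which has a flag of subvarieties $$\mathcal{F}:\ \mathcal{X}=V_0\supset V_1\supset V_2\supset\cdots\supset V_d$$ such that: (1) each $V_i$ is irreducible and defined over $\mathbb{F}_q$; (2) $\dim V_i = d-i$ for each $i$; (3) for each $0\le i\le d-1$, $V_i$ is smooth at the generic point of $V_{i+1}$. Assume moreover that $V_1$ is ample on $\mathcal{X}$ (that is, the complete linear system $|\ell V_1|$ defines a projective embedding of $\mathcal{X}$ for some $\ell\ge 1$). Let $v_{\mathcal{F}}$ be the corresponding composite divisorial valuation of the function field $K=K(\mathcal{X})$, with values in $\mathbb{Z}^d$ ordered lexicographically. Let $R=\bigcup_{m=0}^\infty L(mV_1)$ be the subring of $K$ consisting of functions with poles only along the subvariety $V_1$. Let $\rho(f)=-v_{\mathcal{F}}(f)$ if $f\in R$, $f\neq 0$, and $\rho(0)=-\infty$. Then $\rho$ is an order function on $R$.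
   Context: $\mathbb{F}_q$ is a finite field. Order function: Let $R$ be a commutative $\mathbb{F}_q$-algebra and let $(\Gamma,+,\succ)$ be a well-ordered commutative semigroup (the order is compatible with addition: $\alpha \prec \beta$ implies $\alpha+\gamma \prec \beta+\gamma$). An order function on $R$ is a surjective mapping $\rho : R \to \{-\infty\}\cup\Gamma$ satisfying: (i) $\rho(f) = -\infty \Leftrightarrow f=0$; (ii) $\rho(cf)=\rho(f)$ for all $f \in R$ and all $c\neq 0$ in $\mathbb{F}_q$; (iii) $\rho(f+g) \preceq \max_\succ\{\rho(f),\rho(g)\}$ for all $f,g\in R$; (iv) if $\rho(f)=\rho(g)\ne -\infty$, then there exists $c\neq 0$ in $\mathbb{F}_q$ such that $\rho(f-cg) \prec \rho(f)$; (v) $\rho(fg)=\rho(f)+\rho(g)$. Here $\Gamma=\rho(R\setminus\{0\})\subset\mathbb{Z}^d$ with the lexicographic order. Composite divisorial valuation $v_{\mathcal{F}}$: Each $V_{i+1}$ is an irreducible divisor in $V_i$ and $V_i$ is smooth at its generic point, so each nonzero rational function $g$ on $V_i$ has a well-defined order $\mathrm{ord}_{V_{i+1}}(g)\in\mathbb{Z}$ along $V_{i+1}$ (positive if $g$ vanishes along $V_{i+1}$, negative if $g$ has a pole along $V_{i+1}$). Here $V_d$ is taken to be a smooth $\mathbb{F}_q$-rational point on the irreducible curve $V_{d-1}$. For each $i$ fix a rational function $g_i$ whose restriction to $V_{i-1}$ has a zero of order 1 along $V_i$. For nonzero $f\in K$ define successively $$v_1=\mathrm{ord}_{V_1}(f),\quad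 v_2=\mathrm{ord}_{V_2}\big((f/g_1^{v_1})|_{V_1}\big),\ \ldots,\ v_d=\mathrm{ord}_{V_d}\big((f/(g_1^{v_1}\cdots g_{d-1}^{v_{d-1}}))|_{V_{d-1}}\big),$$ where restrictions are taken successively along the flag, and set $v_{\mathcal{F}}(f)=(v_1,\ldots,v_d)\in\mathbb{Z}^d$. Different choices of the $g_i$ lead to equivalent orderings. All function fields have constant field $\mathbb{F}_q$. $L(mV_1)$ denotes the space consisting of $0$ and the rational functions on $\mathcal{X}$ with a pole of order at most $m$ along $V_1$ and no other poles. *)

(* Defs.v *)
(* Plain MathComp, with the multinomials library and classical logic from
   mathcomp.classical. *)
From HB Require Import structures.
From mathcomp Require Import all_boot all_order all_algebra.
From mathcomp Require Import ring_quotient fraction boolp.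
From mathcomp Require classical_sets.
From mathcomp Require Import mpoly.

Set Implicit Arguments.
Unset Strict Implicit.
Unset Printing Implicit Defensive.

Import Order.TTheory GRing.Theory Num.Theory.
Local Open Scope ring_scope.
Local Open Scope quotient_scope.

(* A closed subvariety of P^n, irreducible and defined over F, given by its
   homogeneous prime ideal in F[X_0, ..., X_n], which must not contain all the
   X_i.  These are also the scheme-theoretic points of P^n over F, so the
   points of V are the Q : projvar F n with Q contained in V (see [vsub]). *)
Record projvar (F : finFieldType) (n : nat) := ProjVar {
  hideal :> prime_idealr {mpoly F[n.+1]};
  hideal_homog :
    forall p, p \in hideal -> forall e, pihomog mdeg e p \in hideal;
  hideal_relevant : exists i, 'X_i \notin hideal
}.

Definition vsub (F : finFieldType) (n : nat) (W V : projvar F n) : Prop :=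
  {subset hideal V <= hideal W}.

Section CoordRing.
Variables (F : finFieldType) (n : nat) (V : projvar F n).

(* The library only makes a quotient by a prime ideal a commutative ring; the
   classical unit predicate and inverse below turn it into an integral domain,
   as needed to form its fraction field. *)
Definition coordring : Type := {ideal_quot (hideal V)}.
HB.instance Definition _ := GRing.ComNzRing.on coordring.

Definition cr_unit (x : coordring) : bool := `[< exists y, y * x = 1 >].
Definition cr_inv (x : coordring) : coordring :=
  if pselect (exists y, y * x = 1) is left h then sval (cid h) else x.

Lemma cr_mulV : {in (cr_unit : {pred coordring}), left_inverse 1 cr_inv *%R}.
Proof.
move=> x /asboolP ux; rewrite /cr_inv; case: pselect => // h.
exact: svalP (cid h).
Qed.

Lemma cr_unitP (x y : coordring) : y * x = 1 -> cr_unit x.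
Proof. by move=> yx; apply/asboolP; exists y. Qed.

Lemma cr_inv_out :
  {in [predC (cr_unit : {pred coordring})], cr_inv =1 id}.
Proof.
move=> x /negP ux; rewrite /cr_inv; case: pselect => // h.
by case: ux; apply/asboolP.
Qed.

HB.instance Definition _ := GRing.ComNzRing_hasMulInverse.Build coordring
  cr_mulV cr_unitP cr_inv_out.
HB.instance Definition _ := GRing.ComUnitRing_isIntegral.Build coordring
  (@Quotient.rquot_IdomainAxiom _ (hideal V)).

Definition crfrac : Type := {fraction coordring}.
HB.instance Definition _ := GRing.Field.on crfrac.

Definition tocr (p : {mpoly F[n.+1]}) : coordring :=
  \pi_({ideal_quot (hideal V)}) p.

Lemma tocrB : {morph tocr : p q / p - q}.
Proof. exact: (rmorphB (\pi_({ideal_quot (hideal V)}))). Qed.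
Lemma tocrM : monoid_morphism tocr.
Proof. by split; [exact: rmorph1 | exact: rmorphM]. Qed.
HB.instance Definition _ := GRing.isZmodMorphism.Build _ _ tocr tocrB.
HB.instance Definition _ := GRing.isMonoidMorphism.Build _ _ tocr tocrM.

Lemma tocr_eq0 p : (tocr p == 0) = (p \in hideal V).
Proof.
rewrite -(rmorph0 tocr) /tocr -[p in RHS]subr0.
by rewrite (Quotient.idealrBE (hideal V)).
Qed.

Definition tofr (p : {mpoly F[n.+1]}) : crfrac := FracField.tofrac (tocr p).

Lemma tofrB : {morph tofr : p q / p - q}.
Proof. by move=> p q; rewrite /tofr !rmorphB. Qed.
Lemma tofrM : monoid_morphism tofr.
Proof. by split=> [|p q]; rewrite /tofr ?rmorph1 // !rmorphM. Qed.
HB.instance Definition _ := GRing.isZmodMorphism.Build _ _ tofr tofrB.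
HB.instance Definition _ := GRing.isMonoidMorphism.Build _ _ tofr tofrM.

Lemma tofr_eq0 p : (tofr p == 0) = (p \in hideal V).
Proof. by rewrite /tofr tofrac_eq0 tocr_eq0. Qed.

Definition hfrac (z : crfrac) : bool :=
  `[< exists e p q, [/\ p \is e.-homog, q \is e.-homog,
        q \notin hideal V & z = tofr p / tofr q] >].

Lemma hfrac_closed : divring_closed (hfrac : {pred crfrac}).
Proof.
split.
- apply/asboolP; exists 0%N, 1, 1; split; rewrite ?dhomog1 ?idealr1 //.
  by rewrite rmorph1 divr1.
- move=> x y /asboolP[e [p [q [hp hq nq ->]]]].
  move=> /asboolP[e' [p' [q' [hp' hq' nq' ->]]]]; apply/asboolP.
  exists (e + e')%N, (p * q' - p' * q), (q * q'); split.
  + by rewrite rpredB ?(dhomogM hp hq') // mulrC; exact: dhomogM hq hp'.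
  + exact: dhomogM hq hq'.
  + by rewrite prime_idealrM negb_or nq.
  by rewrite rmorphB !rmorphM -[- (tofr p' / _)]mulNr
    addf_div ?tofr_eq0 // mulNr.
- move=> x y /asboolP[e [p [q [hp hq nq ->]]]].
  move=> /asboolP[e' [p' [q' [hp' hq' nq' ->]]]]; apply/asboolP.
  case: (boolP (p' \in hideal V)) => [p'0|np'].
    exists 0%N, 0, 1; split; rewrite ?dhomog1 ?idealr1 ?rpred0 //.
    move: p'0; rewrite -tofr_eq0 => /eqP ->.
    by rewrite rmorph0 !mul0r invr0 mulr0.
  exists (e + e')%N, (p * q'), (q * p'); split.
  + exact: dhomogM hp hq'.
  + exact: dhomogM hq hp'.
  + by rewrite prime_idealrM negb_or nq.
  by rewrite !rmorphM invf_div mulf_div.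
Qed.

(* The function field K(V): fractions of degree 0 in Frac(F[X]/I(V)). *)
Record funfield : Type := FunField { ffval :> crfrac; _ : hfrac ffval }.
HB.instance Definition _ := [isSub for ffval].
HB.instance Definition _ := [Choice of funfield by <:].
HB.instance Definition _ :=
  GRing.SubChoice_isSubIntegralDomain.Build crfrac hfrac funfield hfrac_closed.

Lemma funfield_unit : {mono (val : funfield -> crfrac) : u / u \is a GRing.unit}.
Proof.
move=> u; apply/idP/idP; last exact: rmorph_unit.
move=> uu; have hV : hfrac (val u)^-1.
  have [h1 _ hd] := hfrac_closed.
  by rewrite -[_^-1]mul1r; apply: hd => //; exact: valP.
apply/unitrP; exists (Sub _ hV : funfield).
by split; apply: val_inj; rewrite rmorphM rmorph1 /= ?mulVr ?mulrV.
Qed.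
HB.instance Definition _ :=
  GRing.SubIntegralDomain_isSubField.Build crfrac hfrac funfield funfield_unit.

Lemma hfrac_const (c : F) : hfrac (tofr c%:MP).
Proof.
apply/asboolP; exists 0%N, c%:MP, 1; split; rewrite ?dhomog1 ?idealr1 //.
  by rewrite -[c%:MP]mulr1 mul_mpolyC rpredZ ?dhomog1.
by rewrite rmorph1 divr1.
Qed.

Definition ffconst (c : F) : funfield := FunField (hfrac_const c).
Definition ffscale (c : F) (z : funfield) : funfield := ffconst c * z.

Lemma ffscaleA a b v : ffscale a (ffscale b v) = ffscale (a * b) v.
Proof.
rewrite /ffscale mulrA; congr (_ * _); apply: val_inj.
by rewrite /= mpolyCM rmorphM.
Qed.
Lemma ffscale1 : left_id 1 ffscale.
Proof.
move=> v; rewrite /ffscale -[RHS]mul1r; congr (_ * _); apply: val_inj.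
by rewrite /= mpolyC1 rmorph1.
Qed.
Lemma ffscaleDr : right_distributive ffscale +%R.
Proof. by move=> a u v; rewrite /ffscale mulrDr. Qed.
Lemma ffscaleDl v : {morph ffscale^~ v : a b / a + b}.
Proof.
move=> a b; rewrite /ffscale -mulrDl; congr (_ * _); apply: val_inj.
by rewrite /= mpolyCD rmorphD.
Qed.
HB.instance Definition _ := GRing.Zmodule_isLmodule.Build F funfield
  ffscaleA ffscale1 ffscaleDr ffscaleDl.
Lemma ffscaleAl (a : F) (u v : funfield) : a *: (u * v) = (a *: u) * v.
Proof. exact: mulrA. Qed.
HB.instance Definition _ := GRing.Lmodule_isLalgebra.Build F funfield ffscaleAl.
HB.instance Definition _ := GRing.Lalgebra_isComAlgebra.Build F funfield.

End CoordRing.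

Section Varieties.
Variables (F : finFieldType) (n : nat).
Implicit Types (V W Q : projvar F n).

(* The dimension of V is the transcendence degree of K(V) over F. *)
Definition algindep (V : projvar F n) (r : nat) (t : 'I_r -> funfield V) :=
  forall p : {mpoly F[r]}, mmap (in_alg (funfield V)) t p = 0 -> p = 0.

Definition vdim V (r : nat) : Prop :=
  (exists t : 'I_r -> funfield V, algindep t) /\
  (forall t : 'I_r.+1 -> funfield V, ~ algindep t).

Definition const_field V : Prop :=
  forall z : funfield V, algebraicOver (in_alg (funfield V)) z ->
    exists c : F, z = c%:A.

Definition rational_point V : Prop :=
  exists2 a : 'I_n.+1 -> F, exists i, a i != 0 &
    forall e (p : {mpoly F[n.+1]}), p \is e.-homog ->
      (p \in hideal V) = (p.@[a] == 0).

(* The local ring O_{V,W} of V at the generic point of W, its maximal ideal,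
   and its residue map to K(W); these are meant for W contained in V. *)
Definition locring V W (f : funfield V) : Prop :=
  exists e p q, [/\ p \is e.-homog, q \is e.-homog, q \notin hideal W
    & ffval f = tofr V p / tofr V q].

Definition locmax V W (f : funfield V) : Prop :=
  exists e p q, [/\ p \is e.-homog, q \is e.-homog, q \notin hideal W,
    p \in hideal W & ffval f = tofr V p / tofr V q].

(* The value is unspecified (zero) when f is not in O_{V,W}. *)
Definition restr V W (f : funfield V) : funfield W :=
  classical_sets.xget 0 (fun g : funfield W =>
    exists e p q, [/\ p \is e.-homog, q \is e.-homog, q \notin hideal W,
      ffval f = tofr V p / tofr V q & ffval g = tofr W p / tofr W q]).

(* Jacobian criterion in homogeneous coordinates: at the generic point of W, the
   differentials of the equations of V span a space of dimension n - dim V. *)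
Definition smooth_along V W : Prop :=
  exists r c (f : 'I_c -> {mpoly F[n.+1]}),
    [/\ vdim V r, (r + c = n)%N,
        forall i, f i \in hideal V /\ exists e, f i \is e.-homog &
        \rank (\matrix_(i < c, j < n.+1) tofr W (f i)^`M(j)) = c].

Definition uniformizer V W (t : funfield V) : Prop :=
  locmax W t /\
  forall f, locmax W f -> exists2 a, locring W a & f = a * t.

Definition locunit V W (u : funfield V) : Prop :=
  locring W u /\ ~ locmax W u.

(* The order of f along a divisor W at whose generic point V is smooth, i.e.
   such that O_{V,W} is a discrete valuation ring; unspecified for f = 0. *)
Definition ord V W (f : funfield V) : int :=
  classical_sets.xget 0 (fun k : int =>
    exists t u, [/\ uniformizer W t, locunit W u & f = u * t ^ k]).

(* L(mW).  V need not be normal: having no pole away from W means belonging to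
   the local ring of every point of V that does not lie on W. *)
Definition Lspace V W (m : nat) (f : funfield V) : Prop :=
  f = 0 \/
  (- (m%:Z) <= ord W f /\
   forall Q, vsub Q V -> ~ vsub Q W -> locring Q f).

Definition Lring V W (f : funfield V) : Prop := exists m, Lspace W m f.

(* The rational map [f_0 : ... : f_N] from V to P^N. *)
Section RationalMap.
Variables (V : projvar F n) (N : nat) (f : 'I_N.+1 -> funfield V).

Definition heval (p : {mpoly F[N.+1]}) : funfield V :=
  mmap (in_alg (funfield V)) f p.

(* Near the point Q the map is regular, with values in the standard affine
   chart T_j <> 0. *)
Definition in_chart Q (j : 'I_N.+1) : Prop :=
  f j != 0 /\ forall i, locring Q (f i / f j).

(* The homogeneous form p of degree e vanishes at the image of Q. *)
Definition vanishes_at_image Q (e : nat) (p : {mpoly F[N.+1]}) : Prop :=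
  exists2 j, in_chart Q j & locmax Q (heval p / f j ^+ e).

(* The map is everywhere defined, injective on scheme-theoretic points, and
   O_{V,Q} is the local ring of the image of V at the image of Q; as V is
   projective, this means that it is an isomorphism onto a closed subvariety
   of P^N. *)
Definition proj_embedding : Prop :=
  [/\ forall Q, vsub Q V -> exists j, in_chart Q j,
      forall Q Q', vsub Q V -> vsub Q' V ->
        (forall e p, p \is e.-homog ->
           vanishes_at_image Q e p <-> vanishes_at_image Q' e p) ->
        hideal Q =i hideal Q' &
      forall Q, vsub Q V -> forall h, locring Q h ->
        exists e p q, [/\ p \is e.-homog, q \is e.-homog,
          ~ vanishes_at_image Q e q & h = heval p / heval q]].

Definition basis_of_space (L : funfield V -> Prop) : Prop :=
  [/\ forall i, L (f i),
      forall h, L h -> exists c : 'I_N.+1 -> F, h = \sum_i c i *: f i &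
      forall c : 'I_N.+1 -> F, \sum_i c i *: f i = 0 -> forall i, c i = 0].
End RationalMap.

Definition ample V W : Prop :=
  exists l N (f : 'I_N.+1 -> funfield V),
    [/\ (0 < l)%N, basis_of_space f (Lspace W l) & proj_embedding f].

(* A flag V 0 > V 1 > ... > V d in the variety V 0; the values of V beyond
   index d are irrelevant. *)
Record is_flag (d : nat) (V : nat -> projvar F n) : Prop := IsFlag {
  flag_sub : forall i, (i < d)%N -> vsub (V i.+1) (V i);
  flag_dim : forall i, (i <= d)%N -> vdim (V i) (d - i);
  flag_smooth : forall i, (i < d)%N -> smooth_along (V i) (V i.+1);
  flag_const : forall i, (i <= d)%N -> const_field (V i);
  flag_point : rational_point (V d)
}.

Section FlagValuation.
Variable V : nat -> projvar F n.

(* Successive restriction V 0 -> V 1 -> ... -> V i of rational functions, and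
   the condition for it to be defined. *)
Fixpoint restr_to (i : nat) (f : funfield (V 0)) : funfield (V i) :=
  if i is j.+1 then restr (V j.+1) (restr_to j f) else f.

Fixpoint restrictable (i : nat) (f : funfield (V 0)) : Prop :=
  if i is j.+1 then restrictable j f /\ locring (V j.+1) (restr_to j f)
  else True.

Definition ord_at (i : nat) (f : funfield (V 0)) : int :=
  ord (V i.+1) (restr_to i f).

(* Indices are shifted by one: g i is a local equation of V i.+1 in V i. *)
Definition flag_equations (d : nat) (g : nat -> funfield (V 0)) : Prop :=
  forall i, (i < d)%N -> restrictable i (g i) /\ ord_at i (g i) = 1.

Variable g : nat -> funfield (V 0).

Fixpoint flag_quot (f : funfield (V 0)) (i : nat) : funfield (V 0) :=
  if i is j.+1 then flag_quot f j / g j ^ ord_at j (flag_quot f j) else f.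

Definition flag_val (d : nat) (f : funfield (V 0)) : 'rV[int]_d :=
  \row_(i < d) ord_at i (flag_quot f i).

(* [None] stands for -oo. *)
Definition flag_rho (d : nat) (f : funfield (V 0)) : option 'rV[int]_d :=
  if f == 0 then None else Some (- flag_val d f).
End FlagValuation.
End Varieties.

Definition lexlt (d : nat) (a b : 'rV[int]_d) : bool :=
  (([tuple a 0 i | i < d] : d.-tuplelexi int) < [tuple b 0 i | i < d])%O.

Section OrderFunction.

(* A well-ordered commutative semigroup, as a subset G of a commutative monoid
   T with a strict order. *)
Record wo_semigroup (T : nmodType) (G : T -> Prop) (lt : rel T) : Prop :=
  WoSemigroup {
    wos_add : forall a b, G a -> G b -> G (a + b);
    wos_irr : forall a, G a -> ~~ lt a a;
    wos_trans : forall a b c, G a -> G b -> G c -> lt a b -> lt b c -> lt a c;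
    wos_total : forall a b, G a -> G b -> [\/ lt a b, a = b | lt b a];
    wos_min : forall S : T -> Prop, (forall a, S a -> G a) ->
      (exists a, S a) -> exists2 m, S m & forall a, S a -> a = m \/ lt m a;
    wos_addl : forall a b c, G a -> G b -> G c -> lt a b -> lt (a + c) (b + c)
  }.

(* Order and addition on {-oo} + T, with [None] as -oo. *)
Definition olt (T : Type) (lt : rel T) (x y : option T) : bool :=
  match x, y with
  | _, None => false
  | None, Some _ => true
  | Some a, Some b => lt a b
  end.
Definition omax (T : Type) (lt : rel T) (x y : option T) : option T :=
  if olt lt x y then y else x.
Definition oplus (T : nmodType) (x y : option T) : option T :=
  match x, y with
  | Some a, Some b => Some (a + b)
  | _, _ => None
  end.

(* The algebra is a unital subalgebra R of the ambient algebra A; values of rho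
   outside R are irrelevant. *)
Record order_function (F : finFieldType) (A : comAlgType F) (R : A -> Prop)
    (T : nmodType) (G : T -> Prop) (lt : rel T) (rho : A -> option T) : Prop :=
  OrderFunction {
    of_one : R 1;
    of_lin : forall c f g, R f -> R g -> R (c *: f + g);
    of_mul : forall f g, R f -> R g -> R (f * g);
    of_semigroup : wo_semigroup G lt;
    of_values : forall f, R f -> forall a, rho f = Some a -> G a;
    of_surj : forall a, G a -> exists2 f, R f & rho f = Some a;
    of_surj_oo : exists2 f, R f & rho f = None;
    of_i : forall f, R f -> rho f = None <-> f = 0;
    of_ii : forall f (c : F), R f -> c != 0 -> rho (c *: f) = rho f;
    of_iii : forall f g, R f -> R g ->
      rho (f + g) = omax lt (rho f) (rho g) \/
      olt lt (rho (f + g)) (omax lt (rho f) (rho g));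
    of_iv : forall f g, R f -> R g -> rho f = rho g -> rho f <> None ->
      exists2 c : F, c != 0 & olt lt (rho (f - c *: g)) (rho f);
    of_v : forall f g, R f -> R g -> rho (f * g) = oplus (rho f) (rho g)
  }.

End OrderFunction.

(* Main.v *)
(* An order function is the negative of a valuation whose residue field is the
   ground field and whose value set is well ordered.

   For the valuation, write W = V_{i+1} in V = V_i.  The local equation g_i
   shows that the maximal ideal of O_{V,W} is generated by one element t.  If
   a nonzero f were divisible by all powers of t, then lifts of a transcendence
   basis of K(W), together with t and f, would be dim V + 1 algebraically
   independent elements of K(V).  So O_{V,W} is a discrete valuation ring, and
   the composite valuation has residue field K(V_d) = F_q.

   Well-ordering follows once every L(mW), W = V_1, is finite: then L(0) is a
   finite domain, hence consists of constants, so the first coordinate of rho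
   is nonnegative, and it takes a given value only on a finite set.  For the
   finiteness of L(mW), let S be the homogeneous coordinate ring and choose
   a form y_0 in I(W) and forms y_1, ..., y_r such that S is finite over the
   polynomial ring A = F_q[y_0, ..., y_r].  For h in L(mW), the denominators
   of y_0^m h include a power of y_0 (h is regular off W) and an element of A
   prime to y_0 (y_0^m h is regular at W).  A fixed Delta in A carries S into
   a free A-module, in which two coprime denominators cancel; so the fixed form
   Delta y_0^m is a denominator of every h in L(mW), and the numerator has
   bounded degree. *)

Require Import Defs.
From HB Require Import structures.
From mathcomp Require Import all_boot all_order all_fingroup all_algebra.
From mathcomp Require Import pgroup abelian finfield.
From mathcomp Require Import ring_quotient fraction boolp.
From mathcomp Require classical_sets.
From mathcomp Require Import mpoly ring zify.

Set Implicit Arguments.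
Unset Strict Implicit.
Unset Printing Implicit Defensive.

Import Order.TTheory GRing.Theory Num.Theory.
Local Open Scope ring_scope.
Local Arguments pihomog : simpl never.

(** * Homogeneous ideals of a polynomial ring *)

Section GradedIdeals.
Variables (F : finFieldType) (n : nat).
Implicit Types (p q : {mpoly F[n]}) (J : {mpoly F[n]} -> Prop).

(** Points are homogeneous primes, so the existence of a denominator of a given kind is proved by
    contradiction: if the homogeneous ideal of denominators of h misses a multiplicative set of
    forms, Zorn's lemma gives a prime containing the ideal and missing the set. This is a point of
    V, where regularity of h or incomparability yields a contradiction. The choice of y_0, ..., y_r
    is constrained twice: y_0 must be a power of a given form vanishing on W, and over a finite
    field no linear change of coordinates need avoid the zeros of a relation. So y_j is replaced by
    y_j^Q - y_j u^(Q-1) - u^Q, with Q a power of q: where this vanishes and u does not, t = y_j/u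
    satisfies t^Q = t + 1, and suitable Q keep such t away from the zeros of a given nonzero
    polynomial. The axioms of an order function are read off the composite valuation ring: the value
    of f is at most that of h exactly when h/f restricts all the way down to V_d, so comparisons
    become closure properties of a ring. *)

Lemma pihomog_ge e p : (mmeasure mdeg p <= e)%N -> pihomog mdeg e p = 0.
Proof.
move=> pe; rewrite pihomogE big_seq_cond big1 // => m /andP[mp /eqP me].
by have := leq_trans (mmeasure_mnm_lt mdeg mp) pe; rewrite me ltnn.
Qed.

Lemma pihomogMr e k p q : q \is k.-homog ->
  pihomog mdeg (e + k) (p * q) = pihomog mdeg e p * q.
Proof.
move=> hq; have [l hl] : exists l, (mmeasure mdeg p <= l)%N by exists (mmeasure mdeg p).
rewrite {1}(pihomog_partitionE hl) mulr_suml raddf_sum /=.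
have h0 i : pihomog mdeg (e + k) (pihomog mdeg i p * q) =
    if i == e then pihomog mdeg e p * q else 0.
  have hi := dhomogM (pihomogP mdeg i p) hq.
  case: eqP => [<-|/eqP ne]; first by rewrite pihomog_dE.
  by rewrite (pihomog_ne0 _ hi) // eqn_add2r.
under eq_bigr => i _ do rewrite h0.
rewrite -big_mkcond /=.
case: (ltnP e l) => el.
  by rewrite (big_pred1 (Ordinal el)).
rewrite big_pred0 => [|i]; last by apply/negbTE; rewrite neq_ltn (leq_trans _ el).
by rewrite pihomog_ge ?mul0r // (leq_trans hl).
Qed.

Lemma pihomogMr_lt e k p q : q \is k.-homog -> (e < k)%N ->
  pihomog mdeg e (p * q) = 0.
Proof.
move=> hq ek; rewrite {1}(pihomog_partitionE (leqnn (mmeasure mdeg p))).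
rewrite mulr_suml raddf_sum /= big1 // => i _.
have hi := dhomogM (pihomogP mdeg i p) hq.
rewrite (pihomog_ne0 _ hi) // neq_ltn; apply/orP; right.
exact: leq_trans ek (leq_addl _ _).
Qed.

Lemma homog_size_le e p : p \is e.-homog -> (mmeasure mdeg p <= e.+1)%N.
Proof.
move=> /dhomogP hp; apply/bigmax_leqP_seq => m mp _.
by rewrite (hp m mp).
Qed.

(** Predicates in [Prop], possibly improper: the ideals that occur are given by existential
    formulas, such as the denominators of a function. *)
Record hideal_pred J : Prop := HIdealPred {
  hidl0 : J 0;
  hidlD : forall p q, J p -> J q -> J (p + q);
  hidlM : forall p q, J q -> J (p * q);
  hidl_pi : forall e p, J p -> J (pihomog mdeg e p)
}.

Lemma hidlN J p : hideal_pred J -> J p -> J (- p).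
Proof. by move=> hJ Jp; rewrite -mulN1r; apply: hidlM. Qed.

Lemma hidlB J p q : hideal_pred J -> J p -> J q -> J (p - q).
Proof. by move=> hJ Jp Jq; apply: hidlD => //; apply: hidlN. Qed.

Lemma hidlMr J p q : hideal_pred J -> J p -> J (p * q).
Proof. by move=> hJ Jp; rewrite mulrC; apply: hidlM. Qed.

Lemma hidl_sum J I (r : seq I) (P : pred I) (f : I -> {mpoly F[n]}) :
  hideal_pred J -> (forall i, P i -> J (f i)) -> J (\sum_(i <- r | P i) f i).
Proof.
move=> hJ hf; elim/big_rec: _ => [|i x Pi Jx]; first exact: hidl0.
by apply: hidlD => //; apply: hf.
Qed.

Lemma hidl_piN J p : hideal_pred J -> ~ J p -> exists e, ~ J (pihomog mdeg e p).
Proof.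
move=> hJ nJ; apply/not_existsP => h; apply: nJ.
rewrite (pihomog_partitionE (leqnn (mmeasure mdeg p))).
by apply: hidl_sum => // i _; apply: contrapT => /h.
Qed.

Lemma hidl_addp J a e : a \is e.-homog -> hideal_pred J ->
  hideal_pred (fun p => exists u v, J u /\ p = u + v * a).
Proof.
move=> ha hJ; split.
- by exists 0, 0; rewrite mul0r addr0; split=> //; apply: hidl0.
- move=> p q [u [v [Ju ->]]] [u' [v' [Ju' ->]]]; exists (u + u'), (v + v').
  by split; [apply: hidlD | rewrite mulrDl addrACA].
- move=> p q [u [v [Ju ->]]]; exists (p * u), (p * v).
  by split; [apply: hidlM | rewrite mulrDr mulrA].
- move=> k p [u [v [Ju ->]]]; rewrite pihomogD.
  case: (ltnP k e) => ke.
    exists (pihomog mdeg k u), 0; split; first exact: hidl_pi.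
    by rewrite (pihomogMr_lt _ ha ke) mul0r.
  exists (pihomog mdeg k u), (pihomog mdeg (k - e) v); split; first exact: hidl_pi.
  by rewrite -(pihomogMr _ _ ha) subnK.
Qed.

Definition ptrunc k p := \sum_(i < k) pihomog mdeg i p.

Lemma pihomog_trunc k e p :
  pihomog mdeg e (ptrunc k p) = if (e < k)%N then pihomog mdeg e p else 0.
Proof.
rewrite /ptrunc raddf_sum /=.
have h0 i : pihomog mdeg e (pihomog mdeg i p) =
    if i == e then pihomog mdeg e p else 0.
  case: eqP => [->|/eqP ne]; first by rewrite pihomog_id.
  by rewrite (pihomog_ne0 ne (pihomogP _ _ _)).
under eq_bigr => i _ do rewrite h0.
rewrite -big_mkcond /=; case: (ltnP e k) => ek.
  by rewrite (big_pred1 (Ordinal ek)).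
by rewrite big_pred0 // => i; apply/negbTE; rewrite neq_ltn (leq_trans _ ek).
Qed.

Lemma pihomog_top i j p q : (mmeasure mdeg p <= i.+1)%N ->
  (mmeasure mdeg q <= j.+1)%N ->
  pihomog mdeg (i + j) (p * q) = pihomog mdeg i p * pihomog mdeg j q.
Proof.
move=> hp hq; rewrite {1}(pihomog_partitionE hp) big_ord_recr mulrDl raddfD /=.
have hh a r : (a < i)%N -> (mmeasure mdeg r <= j.+1)%N ->
    pihomog mdeg (i + j) (pihomog mdeg a p * r) = 0.
  move=> ai hr; rewrite (pihomog_partitionE hr) mulr_sumr raddf_sum big1 //=.
  move=> b _; have h := dhomogM (pihomogP mdeg a p) (pihomogP mdeg b r).
  rewrite (pihomog_ne0 _ h) // neq_ltn; apply/orP; left.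
  by rewrite -addSn leq_add // -ltnS.
rewrite mulr_suml raddf_sum big1 ?add0r => [|a _]; last by rewrite /= hh.
rewrite {1}(pihomog_partitionE hq) big_ord_recr mulrDr raddfD /=.
rewrite [X in _ + X]pihomog_dE; last by apply: dhomogM; apply: pihomogP.
rewrite mulr_sumr raddf_sum big1 ?add0r //= => b _.
have h := dhomogM (pihomogP mdeg i p) (pihomogP mdeg b q).
by rewrite (pihomog_ne0 _ h) // neq_ltn ltn_add2l ltn_ord.
Qed.

Lemma ptrunc_size k p : (mmeasure mdeg (ptrunc k p) <= k)%N.
Proof.
apply: leq_trans (mmeasure_sum _ _ _ _) _.
by apply/bigmax_leqP => i _; apply: leq_trans (homog_size_le (pihomogP _ _ _)) _.
Qed.

(** Modulo [J] each factor may be cut off above its last component outside [J]; then the top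
    component of the product is the product of the two top components, which are forms. *)
Lemma hidl_prime J : hideal_pred J ->
  (forall d e p q, p \is d.-homog -> q \is e.-homog -> J (p * q) -> J p \/ J q) ->
  forall p q, J (p * q) -> J p \/ J q.
Proof.
move=> hJ hp p q Jpq; apply: contrapT => /not_orP[nJp nJq].
have top r : ~ J r -> exists e, ~ J (pihomog mdeg e r) /\ J (r - ptrunc e.+1 r).
  move=> nJr; have [e0 he0] := hidl_piN hJ nJr.
  have ex : exists e, `[< ~ J (pihomog mdeg e r) >] by exists e0; apply/asboolP.
  have ub e : `[< ~ J (pihomog mdeg e r) >] -> (e <= mmeasure mdeg r)%N.
    move=> /asboolP nJe; rewrite leqNgt; apply/negP => lt_e; apply: nJe.
    by rewrite pihomog_ge 1?ltnW //; exact: hidl0.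
  case: (ex_maxnP ex ub) => e /asboolP ne hmax; exists e; split=> //.
  apply: contrapT => /(hidl_piN hJ)[k]; rewrite raddfB /= pihomog_trunc.
  case: (ltnP k e.+1) => ek; first by rewrite subrr; apply; exact: hidl0.
  rewrite subr0 => nk; have := hmax k; rewrite leqNgt ek.
  by move/(_ (introT (asboolP _) nk)).
have [i [npi hi]] := top _ nJp; have [j [nqj hj]] := top _ nJq.
suff : J (pihomog mdeg i p * pihomog mdeg j q).
  by case/(hp i j _ _ (pihomogP _ _ _) (pihomogP _ _ _)).
set p' := ptrunc i.+1 p in hi; set q' := ptrunc j.+1 q in hj.
have J' : J (p' * q').
  have -> : p' * q' = p * q - ((p - p') * q' + p * (q - q')).
    by ring.
  by apply: hidlB => //; apply: hidlD => //; [apply: hidlMr | apply: hidlM].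
have := hidl_pi hJ (i + j) J'.
by rewrite pihomog_top ?ptrunc_size // !pihomog_trunc !ltnSn.
Qed.

End GradedIdeals.

(** * Homogeneous primes avoiding a multiplicative set of forms *)

Section PrimeExistence.
Variables (F : finFieldType) (n : nat).
Implicit Types (p q : {mpoly F[n.+1]}) (J : {mpoly F[n.+1]} -> Prop).

Lemma homog_pos_span (Q : {mpoly F[n.+1]} -> Prop) e p : hideal_pred Q ->
  (forall i, Q 'X_i) -> p \is e.-homog -> (0 < e)%N -> Q p.
Proof.
move=> hQ QX /dhomogP hp e0; rewrite [p]mpolyE big_seq; apply: hidl_sum => // m mp.
have [i mi] : exists i, m i != 0%N.
  apply/existsP; apply: contraLR e0; rewrite negb_exists => /forallP h.
  rewrite -(hp m mp) -leqNgt leqn0 mdeg_eq0; apply/eqP/mnmP => i.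
  by rewrite mnm0E; apply/eqP; have := h i; rewrite negbK.
have -> : m = (m - U_(i) + U_(i))%MM by rewrite submK // lep1mP.
by rewrite -mul_mpolyC mpolyXD mulrA; apply: hidlM.
Qed.

(* Homogeneous version of Krull's separation lemma. *)
Lemma exists_projvar J (M : {mpoly F[n.+1]} -> Prop) :
  hideal_pred J -> M 1 -> (forall p q, M p -> M q -> M (p * q)) ->
  (forall p, M p -> exists e, p \is e.-homog) ->
  (exists e p, [/\ M p, p \is e.-homog & (0 < e)%N]) ->
  (forall p, J p -> ~ M p) ->
  exists Q : projvar F n, (forall p, J p -> p \in hideal Q) /\
    (forall p, M p -> p \notin hideal Q).
Proof.
move=> hJ M1 MM Mh [e0 [y [My hy e0_gt0]]] JM.
pose good (A : classical_sets.set {mpoly F[n.+1]}) :=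
  [/\ hideal_pred A, forall p, J p -> A p & forall p, A p -> ~ M p].
have [F0 FP totF|Q [QP Qmax]] :=
  @classical_sets.Zorn_bigcup _ (fun A => A = classical_sets.set0 \/ good A).
  case: (pselect (exists A, F0 A /\ good A)) => [[A0 [FA0 gA0]]|nA]; last first.
    left; apply/classical_sets.seteqP; split=> // p [A FA Ap].
    case: (FP _ FA) => [A0|gA]; first by move: Ap; rewrite A0.
    by case: nA; exists A.
  right; have good_of A p : F0 A -> A p -> good A.
    by move=> FA Ap; case: (FP _ FA) => // A0'; move: Ap; rewrite A0'.
  case: (gA0) => hA0 JA0 MA0; split.
  - split.
    + by exists A0 => //; apply: hidl0.
    + move=> p q [A FA Ap] [B FB Bq].
      have [hA _ _] := good_of _ _ FA Ap; have [hB _ _] := good_of _ _ FB Bq.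
      have [AB|BA] := totF _ _ FA FB.
        by exists B => //; apply: hidlD => //; apply: AB.
      by exists A => //; apply: hidlD => //; apply: BA.
    + move=> p q [A FA Aq]; have [hA _ _] := good_of _ _ FA Aq.
      by exists A => //; apply: hidlM.
    + move=> e p [A FA Ap]; have [hA _ _] := good_of _ _ FA Ap.
      by exists A => //; apply: hidl_pi.
  - by move=> p Jp; exists A0 => //; apply: JA0.
  - by move=> p [A FA Ap]; have [_ _] := good_of _ _ FA Ap; apply.
have gQ : good Q.
  case: QP => // Q0; case: (Qmax J); last by right; split.
  rewrite Q0; split; first by move=> p [].
  by move=> h; apply: (h 0); apply: hidl0.
have [hQ JQ MQ] := gQ.
have Qadd e a : a \is e.-homog -> ~ Q a -> exists m u v, [/\ M m, Q u & m = u + v * a].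
  move=> ha nQa; apply: contrapT => h.
  apply: (Qmax (fun p => exists u v, Q u /\ p = u + v * a)).
    split; first by move=> p Qp; exists p, 0; rewrite mul0r addr0.
    move=> h'; apply: nQa; apply: h'; exists 0, 1; rewrite add0r mul1r.
    by split => //; apply: hidl0.
  right; split; first exact: hidl_addp ha hQ.
    by move=> p /JQ Qp; exists p, 0; rewrite mul0r addr0.
  by move=> p [u [v [Qu ->]]] Mp; apply: h; exists (u + v * a), u, v.
have Qprime : forall p q, Q (p * q) -> Q p \/ Q q.
  apply: hidl_prime => // d e p q hp hq Qpq.
  apply: contrapT => /not_orP[nQp nQq].
  have [m [u [v [Mm Qu Em]]]] := Qadd _ _ hp nQp.
  have [m' [u' [v' [Mm' Qu' Em']]]] := Qadd _ _ hq nQq.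
  apply: (MQ (m * m')); last exact: MM.
  rewrite Em mulrDl; apply: hidlD => //; first exact: hidlMr.
  rewrite Em' mulrDr; apply: hidlD => //; first exact: hidlM.
  by rewrite mulrACA; apply: hidlM.
pose Qb : {mpoly F[n.+1]} -> bool := fun p => `[< Q p >].
have Qid : idealr_closed (Qb : {pred _}).
  split; first by apply/asboolP; apply: hidl0.
    by apply/asboolP => Q1; exact: (MQ 1).
  move=> a u v /asboolP Qu /asboolP Qv; apply/asboolP.
  by apply: hidlD => //; apply: hidlM.
have Qpr : prime_idealr_closed (Qb : {pred _}).
  by move=> u v /asboolP/Qprime[] h; apply/orP; [left|right]; apply/asboolP.
pose i1 := isIdealr.Build _ Qb Qid.
pose i2 := isPrimeIdealrClosed.Build _ Qb Qpr.
pose Qi : prime_idealr {mpoly F[n.+1]} := HB.pack Qb i1 i2.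
have Qhom : forall p, p \in (Qi : pred _) -> forall e, pihomog mdeg e p \in (Qi : pred _).
  by move=> p /asboolP Qp e; apply/asboolP; apply: hidl_pi.
(* [Q] is not the irrelevant ideal because it misses the form [y] of positive degree, which lies in
   [M]. *)
have Qrel : exists i, 'X_i \notin (Qi : pred _).
  apply: contrapT => nX; apply: (MQ y) => //.
  apply: homog_pos_span hy e0_gt0 => // i.
  by apply: contrapT => nQ; apply: nX; exists i; apply/asboolP.
exists (ProjVar Qhom Qrel); split=> p; first by move=> Jp; apply/asboolP/JQ.
by move=> Mp; apply/asboolP => /MQ.
Qed.

End PrimeExistence.

(** * Local rings of a projective variety *)

Section LocalRing.
Variables (F : finFieldType) (n : nat).
Implicit Types V W Q : projvar F n.

Lemma tofr_neq0 V q : q \notin hideal V -> tofr V q != 0.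
Proof. by rewrite tofr_eq0. Qed.

Lemma mkff V e p q : p \is e.-homog -> q \is e.-homog -> q \notin hideal V ->
  exists f : funfield V, ffval f = tofr V p / tofr V q.
Proof.
move=> hp hq nq.
have h : hfrac (tofr V p / tofr V q) by apply/asboolP; exists e, p, q.
by exists (FunField h).
Qed.

Lemma ffvalP V (f : funfield V) : exists e p q,
  [/\ p \is e.-homog, q \is e.-homog, q \notin hideal V
    & ffval f = tofr V p / tofr V q].
Proof. by case: f => z hz; apply/asboolP. Qed.

Lemma ff_inj V (f g : funfield V) : ffval f = ffval g -> f = g.
Proof. exact: val_inj. Qed.

Lemma ffvalD V (f g : funfield V) : ffval (f + g) = ffval f + ffval g.
Proof. by []. Qed.
Lemma ffvalM V (f g : funfield V) : ffval (f * g) = ffval f * ffval g.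
Proof. by []. Qed.
Lemma ffval0 V : ffval (0 : funfield V) = 0.
Proof. by []. Qed.
Lemma ffvalX V (f : funfield V) k : ffval (f ^+ k) = ffval f ^+ k.
Proof. by elim: k => // k IH; rewrite !exprS ffvalM IH. Qed.
Lemma ffval_eq0 V (f : funfield V) : (ffval f == 0) = (f == 0).
Proof. by apply/eqP/eqP => [h|->//]; apply: val_inj. Qed.
Lemma ffvalV V (f : funfield V) : ffval f^-1 = (ffval f)^-1.
Proof.
case: (eqVneq f 0) => [->|nf]; first by rewrite invr0 ffval0 invr0.
apply: (mulfI (x := ffval f)); first by rewrite ffval_eq0.
by rewrite -ffvalM mulfV // mulfV // ffval_eq0.
Qed.

Lemma ffval_alg V (c : F) : ffval (c%:A : funfield V) = tofr V c%:MP.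
Proof.
have -> : c%:A = ffscale (V := V) c 1 by [].
by rewrite /ffscale mulr1.
Qed.

Lemma mpolyC_homog (c : F) : (c%:MP : {mpoly F[n.+1]}) \is 0.-homog.
Proof. by rewrite -[c%:MP]mulr1 mul_mpolyC rpredZ ?dhomog1. Qed.

Lemma tofrC V (c : F) : c != 0 -> c%:MP \notin hideal V.
Proof.
move=> c0; apply/negP => h; have := idealMr (c^-1)%:MP h.
by rewrite -mpolyCM mulVf // idealr1.
Qed.

Section Pair.
Variables (V W : projvar F n).
Hypothesis WV : vsub W V.

Lemma notin_vsub q : q \notin hideal W -> q \notin hideal V.
Proof. by apply: contra; apply: WV. Qed.

Lemma frac_eqP (p q p' q' : {mpoly F[n.+1]}) :
  q \notin hideal V -> q' \notin hideal V ->
  tofr V p / tofr V q = tofr V p' / tofr V q' ->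
  p * q' - p' * q \in hideal V.
Proof.
move=> /tofr_neq0 nq /tofr_neq0 nq' E.
have := eqr_div (tofr V p) (tofr V p') nq nq'; rewrite E eqxx => /esym/eqP E2.
by rewrite -tofr_eq0 rmorphB !rmorphM /= E2 subrr.
Qed.

Lemma frac_eq_res (p q p' q' : {mpoly F[n.+1]}) :
  q \notin hideal W -> q' \notin hideal W ->
  tofr V p / tofr V q = tofr V p' / tofr V q' ->
  tofr W p / tofr W q = tofr W p' / tofr W q'.
Proof.
move=> nq nq' E; have := frac_eqP (notin_vsub nq) (notin_vsub nq') E.
move/WV; rewrite -tofr_eq0 rmorphB !rmorphM /= subr_eq0 => E2.
by apply/eqP; rewrite (eqr_div _ _ (tofr_neq0 nq) (tofr_neq0 nq')).
Qed.

(** The fraction picked by the definition does not matter: two fractions that are equal on [V], with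
    denominators nonzero on [W], are equal on [W]. *)
Lemma restrE (f : funfield V) e p q :
  p \is e.-homog -> q \is e.-homog -> q \notin hideal W ->
  ffval f = tofr V p / tofr V q ->
  ffval (restr W f) = tofr W p / tofr W q.
Proof.
move=> hp hq nq E; rewrite /restr.
case: classical_sets.xgetP => [g _ [e' [p' [q' [hp' hq' nq' E' ->]]]]|].
  by apply: frac_eq_res => //; rewrite -E -E'.
have [g Eg] := mkff hp hq nq; move/(_ g); case; exists e, p, q; by split.
Qed.

Lemma locmaxW (f : funfield V) : locmax W f -> locring W f.
Proof. by move=> [e [p [q [? ? ? ? ?]]]]; exists e, p, q. Qed.

Lemma locring_max (f : funfield V) : locring W f ->
  locmax W f <-> restr W f = 0.
Proof.
move=> [e [p [q [hp hq nq E]]]]; split.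
  move=> [e' [p' [q' [hp' hq' nq' p0 E']]]]; apply: ff_inj.
  rewrite (restrE hp' hq' nq' E') ffval0.
  by move: p0; rewrite -tofr_eq0 => /eqP ->; rewrite mul0r.
move=> /(congr1 (@ffval _ _ _)); rewrite (restrE hp hq nq E) ffval0 => /eqP.
rewrite mulf_eq0 invr_eq0 !tofr_eq0 (negPf nq) orbF => p0.
by exists e, p, q.
Qed.

Lemma locringD (f g : funfield V) : locring W f -> locring W g ->
  locring W (f + g) /\ restr W (f + g) = restr W f + restr W g.
Proof.
move=> [e [p [q [hp hq nq E]]]] [e' [p' [q' [hp' hq' nq' E']]]].
have h1 : p * q' + p' * q \is (e + e').-homog.
  by apply: rpredD; [exact: dhomogM | rewrite addnC; exact: dhomogM].
have h2 : q * q' \is (e + e').-homog by exact: dhomogM.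
have h3 : q * q' \notin hideal W by rewrite prime_idealrM negb_or nq.
have Efg : ffval (f + g) = tofr V (p * q' + p' * q) / tofr V (q * q').
  rewrite ffvalD E E' rmorphD !rmorphM.
  exact: addf_div (tofr_neq0 (notin_vsub nq)) (tofr_neq0 (notin_vsub nq')).
split; first by exists (e + e')%N, (p * q' + p' * q), (q * q').
apply: ff_inj; rewrite (restrE h1 h2 h3 Efg).
rewrite ffvalD (restrE hp hq nq E) (restrE hp' hq' nq' E').
by rewrite (addf_div _ _ (tofr_neq0 nq) (tofr_neq0 nq')) rmorphD !rmorphM.
Qed.

Lemma locringM (f g : funfield V) : locring W f -> locring W g ->
  locring W (f * g) /\ restr W (f * g) = restr W f * restr W g.
Proof.
move=> [e [p [q [hp hq nq E]]]] [e' [p' [q' [hp' hq' nq' E']]]].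
have h1 : p * p' \is (e + e').-homog by exact: dhomogM.
have h2 : q * q' \is (e + e').-homog by exact: dhomogM.
have h3 : q * q' \notin hideal W by rewrite prime_idealrM negb_or nq.
have Efg : ffval (f * g) = tofr V (p * p') / tofr V (q * q').
  by rewrite ffvalM E E' mulf_div !rmorphM.
split; first by exists (e + e')%N, (p * p'), (q * q').
apply: ff_inj; rewrite (restrE h1 h2 h3 Efg).
rewrite ffvalM (restrE hp hq nq E) (restrE hp' hq' nq' E').
by rewrite mulf_div !rmorphM.
Qed.

Lemma locringC (c : F) : locring W (c%:A : funfield V) /\
  restr W (c%:A : funfield V) = c%:A.
Proof.
have h1 := mpolyC_homog c; have h2 := dhomog1 F (mdeg (n:=n.+1)).
have h3 : 1 \notin hideal W by rewrite idealr1.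
have E : ffval (c%:A : funfield V) = tofr V c%:MP / tofr V 1.
  by rewrite rmorph1 divr1 ffval_alg.
split; first by exists 0%N, c%:MP, 1.
by apply: ff_inj; rewrite (restrE h1 h2 h3 E) rmorph1 divr1 -ffval_alg.
Qed.

Lemma locringV (f : funfield V) : locring W f -> restr W f != 0 ->
  locring W f^-1 /\ restr W f^-1 = (restr W f)^-1.
Proof.
move=> [e [p [q [hp hq nq E]]]] nr.
have np : p \notin hideal W.
  move: nr; rewrite -ffval_eq0 (restrE hp hq nq E) mulf_eq0 invr_eq0 !tofr_eq0.
  by rewrite negb_or => /andP[].
have EV : ffval f^-1 = tofr V q / tofr V p by rewrite ffvalV E invf_div.
split; first by exists e, q, p.
by apply: ff_inj; rewrite (restrE hq hp np EV) ffvalV (restrE hp hq nq E) invf_div.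
Qed.

Lemma locring_lift (g : funfield W) : exists2 f : funfield V, locring W f & restr W f = g.
Proof.
have [e [p [q [hp hq nq E]]]] := ffvalP g.
have [f Ef] := mkff hp hq (notin_vsub nq).
exists f; first by exists e, p, q.
by apply: ff_inj; rewrite (restrE hp hq nq Ef).
Qed.

Lemma homog_notin (e : nat) : exists2 l, l \notin hideal W & l \is e.-homog.
Proof.
have [i hi] := hideal_relevant W; exists ('X_i ^+ e).
  elim: e => [|e IH]; first by rewrite expr0 idealr1.
  by rewrite exprS prime_idealrM negb_or hi.
by rewrite -[e in e.-homog]mul1n; apply: dhomogMn; rewrite dhomogX /= mdeg1.
Qed.

(** Dividing both forms of a fraction by a power of a coordinate that does not vanish on [W] turns
    them into elements of the local ring. *)
Lemma ff_locfrac (f : funfield V) : exists a b,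
  [/\ locring W a, locring W b, b != 0 & f = a / b].
Proof.
have [e [p [q [hp hq nq E]]]] := ffvalP f.
have [l nl hl] := homog_notin e.
have [a Ea] := mkff hp hl (notin_vsub nl).
have [b Eb] := mkff hq hl (notin_vsub nl).
exists a, b; split; first by exists e, p, l.
- by exists e, q, l.
- rewrite -ffval_eq0 Eb mulf_eq0 invr_eq0 !tofr_eq0 negb_or nq.
  by apply: notin_vsub.
apply: ff_inj; rewrite ffvalM ffvalV E Ea Eb invf_div mulf_div.
rewrite [tofr V l * _]mulrC -mulf_div divff ?mulr1 //.
exact: tofr_neq0 (notin_vsub nl).
Qed.

End Pair.
End LocalRing.

(** * Places and discrete valuation rings *)

Lemma mmap_muni (F : fieldType) (S : comNzRingType) (i : {rmorphism F -> S}) r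
    (h : 'I_r.+1 -> S) (G : {mpoly F[r.+1]}) :
  mmap i h G =
  (map_poly (mmap i (fun j => h (widen_ord (leqnSn r) j))) (muni G)).[h ord_max].
Proof.
rewrite muniE rmorph_sum /= horner_sum {1}/mmap; apply: eq_bigr => m _.
rewrite -mul_polyC rmorphM /= map_polyC map_polyXn hornerM hornerC hornerXn.
rewrite /= mmapZ mmapX -mulrA.
rewrite /mmap1 big_ord_recr /=; congr (_ * (_ * _)).
by apply: eq_bigr => j _; rewrite mnmE.
Qed.

Lemma muni_inj (F : fieldType) r (G : {mpoly F[r.+1]}) : muni G = 0 -> G = 0.
Proof.
move=> G0; have /= := mmap_muni (@mpolyC r.+1 F) (fun i => 'X_i) G.
rewrite G0 rmorph0 horner0 => <-; rewrite [LHS]mpolyE /mmap.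
by apply: eq_bigr => m _; rewrite mmap1_id mul_mpolyC.
Qed.

Definition algind (F K : fieldType) (i : F -> K) r (t : 'I_r -> K) :=
  forall p : {mpoly F[r]}, mmap i t p = 0 -> p = 0.

Section Place.
Variables (F K k : fieldType).
Variables (iK : {rmorphism F -> K}) (ik : {rmorphism F -> k}).
Variables (O : K -> Prop) (res : K -> k).

Record place : Prop := Place {
  pl_C : forall c, O (iK c) /\ res (iK c) = ik c;
  pl_D : forall f g, O f -> O g -> O (f + g) /\ res (f + g) = res f + res g;
  pl_M : forall f g, O f -> O g -> O (f * g) /\ res (f * g) = res f * res g;
  pl_V : forall f, O f -> res f != 0 -> O f^-1;
  pl_lift : forall g, exists2 f, O f & res f = g;
  pl_frac : forall f, exists a b, [/\ O a, O b, b != 0 & f = a / b]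
}.

Hypothesis pl : place.

Lemma pl_1 : O 1 /\ res 1 = 1.
Proof. by have := pl_C pl 1; rewrite !rmorph1. Qed.

Lemma pl_0 : O 0 /\ res 0 = 0.
Proof. by have := pl_C pl 0; rewrite !rmorph0. Qed.

Lemma pl_N f : O f -> O (- f) /\ res (- f) = - res f.
Proof.
move=> Of; have [h1 h2] := pl_C pl (-1); have := pl_M pl h1 Of.
by rewrite h2 !rmorphN1 !mulN1r.
Qed.

Lemma pl_X f e : O f -> O (f ^+ e) /\ res (f ^+ e) = res f ^+ e.
Proof.
move=> Of; elim: e => [|e [h1 h2]]; first exact: pl_1.
by rewrite !exprS; have [h3 ->] := pl_M pl Of h1; rewrite h2.
Qed.

Lemma pl_neq0 f : res f != 0 -> f != 0.
Proof. by apply: contra => /eqP ->; rewrite pl_0.2. Qed.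

Lemma pl_resV f : O f -> res f != 0 -> res f^-1 = (res f)^-1.
Proof.
move=> Of rf; have [_] := pl_M pl Of (pl_V pl Of rf).
rewrite mulfV ?pl_neq0 // pl_1.2 => E.
by apply: (mulfI rf); rewrite -E mulfV.
Qed.

Lemma pl_sum I (r : seq I) (P : pred I) (f : I -> K) :
  (forall i, P i -> O (f i)) ->
  O (\sum_(i <- r | P i) f i) /\
  res (\sum_(i <- r | P i) f i) = \sum_(i <- r | P i) res (f i).
Proof.
move=> hf; elim: r => [|a r [IH1 IH2]]; first by rewrite !big_nil; exact: pl_0.
rewrite !big_cons; case: ifP => // Pa.
by have [h1 h2] := pl_D pl (hf a Pa) IH1; rewrite h2 IH2.
Qed.

Lemma pl_prod I (r : seq I) (P : pred I) (f : I -> K) :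
  (forall i, P i -> O (f i)) ->
  O (\prod_(i <- r | P i) f i) /\
  res (\prod_(i <- r | P i) f i) = \prod_(i <- r | P i) res (f i).
Proof.
move=> hf; elim: r => [|a r [IH1 IH2]]; first by rewrite !big_nil; exact: pl_1.
rewrite !big_cons; case: ifP => // Pa.
by have [h1 h2] := pl_M pl (hf a Pa) IH1; rewrite h2 IH2.
Qed.

Lemma pl_mmap r (G : {mpoly F[r]}) (x : 'I_r -> K) : (forall i, O (x i)) ->
  O (mmap iK x G) /\ res (mmap iK x G) = mmap ik (fun i => res (x i)) G.
Proof.
move=> hx.
have hm m : O (mmap1 x m) /\ res (mmap1 x m) = mmap1 (fun i => res (x i)) m.
  have [i _|h1 h2] := @pl_prod _ (index_enum 'I_r) xpredT (fun i => x i ^+ m i).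
    by have [] := pl_X (m i) (hx i).
  split=> //; rewrite /mmap1 h2; apply: eq_bigr => i _.
  by have [] := pl_X (m i) (hx i).
have hm2 m : O (iK G@_m * mmap1 x m) /\
    res (iK G@_m * mmap1 x m) = ik G@_m * mmap1 (fun i => res (x i)) m.
  have [h1 h2] := hm m; have [h3 h4] := pl_C pl G@_m.
  by have [h5 h6] := pl_M pl h3 h1; rewrite h6 h2 h4.
have [i _|h1 h2] := @pl_sum _ (msupp G) xpredT (fun m => iK G@_m * mmap1 x m).
  by have [] := hm2 i.
by split=> //; rewrite /mmap h2; apply: eq_bigr => i _; have [] := hm2 i.
Qed.

Definition pmax f := O f /\ res f = 0.

Definition punif t := pmax t /\ forall f, pmax f -> exists2 a, O a & f = a * t.

(** Modulo [t] only the constant coefficient of [p] counts. *)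
Lemma pl_horner (p : {poly K}) t : (forall j, O p`_j) -> pmax t ->
  exists2 w, O w & p.[t] = p`_0 + w * t.
Proof.
move=> hp [Ot rt]; suff: exists2 w, O w & p.[t] = p`_0 + w * t by [].
elim/poly_ind: p hp => [|p c IH] hp.
  by exists 0; [exact: pl_0.1 | rewrite horner0 coef0 mul0r addr0].
have hp' j : O p`_j by have := hp j.+1; rewrite -cons_poly_def coef_cons.
have [w Ow E] := IH hp'; exists p.[t].
  by rewrite E; apply: (pl_D pl _ _).1 => //; apply: (pl_M pl _ _).1.
by rewrite hornerMXaddC -cons_poly_def coef_cons /= addrC.
Qed.

Lemma poly_low (A : idomainType) (p : {poly A}) : p != 0 ->
  exists j q, p = q * 'X^j /\ q`_0 != 0.
Proof.
move=> p0; have [j [q hq E]] := multiplicity_XsubC p 0.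
exists j, q; move: hq E; rewrite p0 subr0 /root horner_coef0 => hq E.
by split.
Qed.

Section Uniformizer.
Variable t : K.
Hypothesis ut : punif t.

Definition ext_fun r (x : 'I_r -> K) (y : K) (i : 'I_r.+1) : K :=
  if unlift ord_max i is Some j then x j else y.

Lemma ext_funE r (x : 'I_r -> K) y :
  (forall j, ext_fun x y (widen_ord (leqnSn r) j) = x j) /\ ext_fun x y ord_max = y.
Proof.
split=> [j|]; last by rewrite /ext_fun unlift_none.
rewrite /ext_fun; have -> : widen_ord (leqnSn r) j = lift ord_max j.
  exact/val_inj/esym/lift_max.
by rewrite liftK.
Qed.

Lemma mmap_ext r (x : 'I_r -> K) y (G : {mpoly F[r.+1]}) :
  mmap iK (ext_fun x y) G = (map_poly (mmap iK x) (muni G)).[y].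
Proof.
rewrite mmap_muni (ext_funE x y).2; congr (_.[_]).
apply/polyP => j; rewrite !coef_map /= /mmap; apply: eq_bigr => m _.
by congr (_ * _); apply: mmap1_eq => l; exact: (ext_funE x y).1.
Qed.

(** The lowest coefficient of [G] in its last variable is a nonzero polynomial; by independence of
    the residues its value at [x] is a unit of [O]. The higher terms contribute multiples of [t], so
    they do not change the residue. *)
Lemma mmap_ext_unit r (x : 'I_r -> K) (G : {mpoly F[r.+1]}) :
  (forall i, O (x i)) -> algind ik (fun i => res (x i)) -> G != 0 ->
  exists j u, [/\ O u, res u != 0 & mmap iK (ext_fun x t) G = u * t ^+ j].
Proof.
move=> Ox xind G0; have mG0 : muni G != 0 by apply: contra G0 => /eqP/muni_inj ->.
have [j [q [E q0]]] := poly_low mG0.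
have Oc l : O (map_poly (mmap iK x) q)`_l.
  by rewrite coef_map; exact: (pl_mmap _ Ox).1.
have [w Ow Ew] := pl_horner Oc ut.1.
exists j, (map_poly (mmap iK x) q).[t].
have [Owt rwt] := pl_M pl Ow ut.1.1.
rewrite mmap_ext E rmorphM /= map_polyXn hornerM hornerXn Ew.
have [h1 ->] := pl_D pl (Oc 0%N) Owt; split => //.
rewrite rwt ut.1.2 mulr0 addr0 coef_map /= (pl_mmap _ Ox).2.
by apply: contra q0 => /eqP/xind ->.
Qed.

(** After division by a power of [f], a relation reads [u * t ^+ l + w * f = 0] with [u] a unit: the
    first term is the lowest coefficient in [f], evaluated by [mmap_ext_unit]. As [f] is divisible
    by [t ^+ l.+1], the unit [u] would be divisible by [t]. *)
Lemma algind_inf r (x : 'I_r -> K) f :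
  (forall i, O (x i)) -> algind ik (fun i => res (x i)) ->
  t != 0 -> f != 0 -> (forall e, exists2 a, O a & f = a * t ^+ e) ->
  algind iK (ext_fun (ext_fun x t) f).
Proof.
move=> Ox xind t0 f0 hf G EG; apply/eqP; case: eqVneq => // G0; exfalso.
have mG0 : muni G != 0 by apply: contra G0 => /eqP/muni_inj ->.
have [j [q [E q0]]] := poly_low mG0.
have Oxt i : O (ext_fun x t i).
  by rewrite /ext_fun; case: unlift => // ; exact: ut.1.1.
have Oc l : O (map_poly (mmap iK (ext_fun x t)) q)`_l.
  by rewrite coef_map; exact: (pl_mmap _ Oxt).1.
have mf : pmax f.
  have [a Oa ->] := hf 1%N; rewrite expr1.
  by have [h1 h2] := pl_M pl Oa ut.1.1; split; rewrite ?h2 ?ut.1.2 ?mulr0.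
have [w Ow Ew] := pl_horner Oc mf.
move/eqP: EG; rewrite mmap_ext E rmorphM /= map_polyXn hornerM hornerXn mulf_eq0.
rewrite (negPf (expf_neq0 _ f0)) orbF Ew coef_map /=.
have [l [u [Ou ru ->]]] := mmap_ext_unit Ox xind q0.
have [a Oa Ea] := hf l.+1.
rewrite Ea exprS => /eqP E0.
have Eu : u = - (w * a * t).
  apply: (mulIf (expf_neq0 l t0)); apply/eqP; rewrite -subr_eq0 -E0.
  by apply/eqP; ring.
have [h1 r1] := pl_M pl Ow Oa; have [h2 r2] := pl_M pl h1 ut.1.1.
by have [h3 r3] := pl_N h2; move: ru; rewrite Eu r3 r2 ut.1.2 mulr0 oppr0 eqxx.
Qed.

Section Dimension.
Variable r : nat.
Hypothesis dimK : exists x : 'I_r.+1 -> K, algind iK x.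
Hypothesis dimK' : forall x : 'I_r.+2 -> K, ~ algind iK x.
Hypothesis dimk : exists x : 'I_r -> k, algind ik x.
Hypothesis dimk' : forall x : 'I_r.+1 -> k, ~ algind ik x.

(** If [t] were 0, the maximal ideal would be 0, so [O] would be all of [K] and [res] would embed
    [K] into [k], against the transcendence degrees. *)
Lemma punif_neq0 : t != 0.
Proof.
apply/eqP => t0; have [x xind] := dimK.
have max0 f : pmax f -> f = 0.
  by move=> /(ut.2 _)[a _]; rewrite t0 mulr0.
have Oall f : O f.
  have [a [b [Oa Ob b0 ->]]] := pl_frac pl f.
  apply: (pl_M pl Oa (pl_V pl Ob _)).1.
  by apply: contra b0 => /eqP rb; apply/eqP/max0.
apply: (dimk' (x := fun i => res (x i))) => G EG; apply: xind; apply: max0.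
by have [h1 h2] := pl_mmap G (fun i => Oall (x i)); split=> //; rewrite h2.
Qed.

Lemma punif_dvr f : O f -> f != 0 ->
  exists e u, [/\ O u, res u != 0 & f = u * t ^+ e].
Proof.
move=> Of f0; apply: contrapT => nf.
have [y yind] := dimk.
have /boolp.choice[x hx] : forall i, exists z, O z /\ res z = y i.
  by move=> i; have [z] := pl_lift pl (y i); exists z.
apply: (@dimK' (ext_fun (ext_fun x t) f)); apply: algind_inf => //.
- by move=> i; have [] := hx i.
- by have -> : (fun i => res (x i)) = y by apply: funext => i; have [] := hx i.
- exact: punif_neq0.
elim=> [|e [a Oa Ea]]; first by exists f => //; rewrite expr0 mulr1.
case: (eqVneq (res a) 0) => [ra|ra]; last by case: nf; exists e, a.
have [b Ob Eb] := ut.2 a (conj Oa ra).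
by exists b => //; rewrite Ea Eb -mulrA -exprS.
Qed.

Lemma punif_ord f : f != 0 ->
  exists (e : int) u, [/\ O u, res u != 0 & f = u * t ^ e].
Proof.
move=> f0; have t0 := punif_neq0.
have [a [b [Oa Ob b0 E]]] := pl_frac pl f.
have a0 : a != 0 by apply: contra f0 => /eqP a0; rewrite E a0 mul0r.
have [e [u [Ou ru Ea]]] := punif_dvr Oa a0.
have [e' [u' [Ou' ru' Eb]]] := punif_dvr Ob b0.
exists (e%:Z - e'%:Z), (u / u'); have OV := pl_V pl Ou' ru'.
have [h1 h2] := pl_M pl Ou OV; split=> //.
  by rewrite h2 (pl_resV Ou' ru') mulf_neq0 ?invr_eq0.
by rewrite E Ea Eb expfzDr // -exprnP -invr_expz -exprnP invfM mulrACA.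
Qed.

End Dimension.
End Uniformizer.
End Place.

(** * Composite valuations *)

Section Dvr.
Variables (F K k : fieldType).
Variables (iK : {rmorphism F -> K}) (ik : {rmorphism F -> k}).
Variables (O : K -> Prop) (res : K -> k) (ord : K -> int).

(** Only a nonzero element of the maximal ideal; the decomposition required in [dvr] is what makes
    it a uniformizer. *)
Definition unit_for t := [/\ O t, res t = 0 & t != 0].

Record dvr : Prop := Dvr {
  dvr_pl : place iK ik O res;
  dvr_t : exists2 t, unit_for t &
    forall f, f != 0 -> exists u, [/\ O u, res u != 0 & f = u * t ^ ord f]
}.

Lemma unit_pow_le (pl : place iK ik O res) t u u' (e e' : int) : unit_for t ->
  O u -> O u' -> res u' != 0 -> u * t ^ e = u' * t ^ e' -> e <= e'.
Proof.
move=> [Ot rt t0] Ou Ou' ru' E; rewrite leNgt; apply/negP => lt_e.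
have [m Em] : exists m : nat, e = e' + m.+1%:Z.
  by exists (absz (e - e' - 1)%R); lia.
move/eqP: ru'; apply; have -> : u' = u * t ^+ m.+1.
  apply: (mulIf (expfz_neq0 e' t0)).
  by rewrite -E Em expfzDr // -exprnP -mulrA [t ^+ _ * _]mulrC.
have [h1 h2] := pl_X pl m.+1 Ot; have [_ ->] := pl_M pl Ou h1.
by rewrite h2 rt expr0n mulr0.
Qed.

Lemma unit_pow_eq (pl : place iK ik O res) t u u' (e e' : int) : unit_for t ->
  O u -> res u != 0 -> O u' -> res u' != 0 -> u * t ^ e = u' * t ^ e' -> e = e'.
Proof.
move=> ht Ou ru Ou' ru' E; apply/le_anti/andP.
by split; [apply: (unit_pow_le pl ht Ou Ou') | apply: (unit_pow_le pl ht Ou' Ou)].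
Qed.

Lemma unit_expz (pl : place iK ik O res) a (e : int) : O a -> res a != 0 ->
  O (a ^ e) /\ res (a ^ e) != 0.
Proof.
move=> Oa ra; have hn b (m : nat) : O b -> res b != 0 ->
    O (b ^+ m) /\ res (b ^+ m) != 0.
  by move=> Ob rb; have [h ->] := pl_X pl m Ob; rewrite expf_neq0.
case: e => m; first by rewrite -exprnP; exact: hn.
rewrite NegzE -exprz_inv -exprnP; apply: hn; first exact: pl_V pl _ Oa ra.
by rewrite (pl_resV pl Oa ra) invr_eq0.
Qed.

Lemma punif_assoc (pl : place iK ik O res) t t' : t != 0 ->
  punif O res t -> punif O res t' -> exists2 a, O a /\ res a != 0 & t' = a * t.
Proof.
move=> t0 [mt ht] [mt' ht']; have [a Oa Ea] := ht _ mt'; have [b Ob Eb] := ht' _ mt.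
exists a => //; split=> //; apply/eqP => ra.
have E : b * a = 1 by apply: (mulIf t0); rewrite mul1r -mulrA -Ea -Eb.
have [_] := pl_M pl Ob Oa; rewrite E ra mulr0 (pl_1 pl).2 => /eqP.
by rewrite oner_eq0.
Qed.

(** The uniformizer may depend on [f], as in the definition by choice of the order along a divisor;
    two uniformizers differ by a unit. *)
Lemma dvr_of_punif (pl : place iK ik O res) t : t != 0 -> punif O res t ->
  (forall f, f != 0 -> exists t' u,
     [/\ punif O res t', O u, res u != 0 & f = u * t' ^ ord f]) -> dvr.
Proof.
move=> t0 ht hord; split=> //; have [[Ot rt] _] := ht; exists t => // f f0.
have [t' [u [ht' Ou ru E]]] := hord f f0.
have [a [Oa ra] Et'] := punif_assoc pl t0 ht ht'.
have [h1 h2] := unit_expz pl (ord f) Oa ra; have [h3 h4] := pl_M pl Ou h1.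
exists (u * a ^ ord f); split=> //; first by rewrite h4 mulf_neq0.
by rewrite {1}E Et' expfzMl mulrA.
Qed.

Hypothesis dv : dvr.
Let pl := dvr_pl dv.

Lemma dvrM f g : f != 0 -> g != 0 -> ord (f * g) = ord f + ord g.
Proof.
move=> f0 g0; have [t ht hord] := dvr_t dv; have [_ _ t0] := ht.
have [u [Ou ru Ef]] := hord f f0; have [u' [Ou' ru' Eg]] := hord g g0.
have [w [Ow rw E]] := hord _ (mulf_neq0 f0 g0).
have [h1 h2] := pl_M pl Ou Ou'.
apply: (unit_pow_eq pl ht Ow rw h1); first by rewrite h2 mulf_neq0.
by rewrite -E {1}Ef {1}Eg expfzDr // mulrACA.
Qed.

Lemma dvr_ge0 f : f != 0 -> (0 <= ord f) <-> O f.
Proof.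
move=> f0; have [t ht hord] := dvr_t dv; have [Ot rt t0] := ht.
have [u [Ou ru E]] := hord f f0; split=> [|Of].
  case Eo: (ord f) E => [e|//] E _; rewrite E -exprnP.
  exact: (pl_M pl Ou (pl_X pl e Ot).1).1.
apply: (unit_pow_le pl ht Of Ou ru).
by rewrite expr0z mulr1.
Qed.

Lemma dvr_eq0 f : f != 0 -> ord f = 0 <-> O f /\ res f != 0.
Proof.
move=> f0; have [t ht hord] := dvr_t dv; have [Ot rt t0] := ht.
have [u [Ou ru E]] := hord f f0; split=> [E0|[Of rf]].
  by move: E; rewrite E0 expr0z mulr1 => ->.
apply: (unit_pow_eq pl ht Ou ru Of rf).
by rewrite -E expr0z mulr1.
Qed.

Lemma dvr_gt0 f : f != 0 -> O f -> res f = 0 -> 0 < ord f.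
Proof.
move=> f0 Of rf; rewrite lt_neqAle eq_sym; apply/andP; split.
  by apply/eqP => /(dvr_eq0 f0).1[_]; rewrite rf eqxx.
exact/(dvr_ge0 f0).
Qed.

Lemma dvr1 : ord 1 = 0.
Proof.
by apply/dvr_eq0; rewrite ?oner_neq0 // (pl_1 pl).2 oner_neq0; have [] := pl_1 pl.
Qed.

Lemma dvrV f : f != 0 -> ord f^-1 = - ord f.
Proof.
move=> f0; apply/eqP; rewrite -addr_eq0 -dvrM ?invr_eq0 //.
by rewrite mulVf // dvr1.
Qed.

Lemma dvrZ f (e : int) : f != 0 -> ord (f ^ e) = ord f * e.
Proof.
move=> f0; have hn (m : nat) : ord (f ^+ m) = ord f * m%:Z.
  elim: m => [|m IH]; first by rewrite expr0 dvr1 mulr0.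
  by rewrite exprS dvrM ?expf_neq0 // IH intS mulrDr mulr1.
case: e => m; first by rewrite -exprnP hn.
by rewrite NegzE -exprz_inv -exprnP exprVn dvrV ?expf_neq0 // hn mulrN.
Qed.

Lemma dvrD f g (m : int) : f != 0 -> g != 0 -> f + g != 0 ->
  m <= ord f -> m <= ord g -> m <= ord (f + g).
Proof.
move=> f0 g0 fg0 mf mg; have [t [Ot rt t0] hord] := dvr_t dv.
have ot : ord t != 0.
  by apply/eqP => /(dvr_eq0 t0).1[_]; rewrite rt eqxx.
(* Division by an element of order [m] reduces the bound to the closure of [O] under addition; a
   power of [t] serves, since [t] has order 1. *)
have [a a0 Ea] : exists2 a, a != 0 & ord a = m.
  have [u [Ou ru E]] := hord t t0; exists (t ^ m); first exact: expfz_neq0.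
  suff E1 : ord t = 1 by rewrite dvrZ // E1 mul1r.
  have h1 : unit_for t by [].
  apply: (unit_pow_eq pl h1 Ou ru (pl_1 pl).1); first by rewrite (pl_1 pl).2 oner_neq0.
  by rewrite -E mul1r expr1z.
have V0 : a^-1 != 0 by rewrite invr_eq0.
have hO h : h != 0 -> m <= ord h <-> O (h / a).
  move=> h0; have ha0 : h / a != 0 by rewrite mulf_neq0.
  by rewrite -(dvr_ge0 ha0) dvrM // dvrV // Ea subr_ge0.
apply/hO => //; rewrite mulrDl.
by apply: (pl_D pl _ _).1; [apply/hO | apply/hO].
Qed.

End Dvr.

(** * The composite valuation of a flag *)

Section Flag.
Variables (F : fieldType) (d : nat) (K : nat -> fieldType).
Variables (iK : forall i, {rmorphism F -> K i}).
Variables (O : forall i, K i -> Prop) (res : forall i, K i -> K i.+1).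
Variables (ord : forall i, K i -> int).
Hypothesis dv : forall i, (i < d)%N -> dvr (iK i) (iK i.+1) (@O i) (@res i) (@ord i).
Hypothesis last_const : forall z : K d, exists c, z = iK d c.

Fixpoint rto i (f : K 0%N) : K i := if i is j.+1 then res (rto j f) else f.

Fixpoint rable i (f : K 0%N) : Prop :=
  if i is j.+1 then rable j f /\ O (rto j f) else True.

Definition oat i (f : K 0%N) : int := ord (rto i f).

Variable g : nat -> K 0%N.
Hypothesis hg : forall i, (i < d)%N ->
  [/\ rable i (g i), rto i (g i) != 0 & oat i (g i) = 1].

Fixpoint fquot (f : K 0%N) i : K 0%N :=
  if i is j.+1 then fquot f j / g j ^ oat j (fquot f j) else f.

Definition fval (f : K 0%N) i : int := oat i (fquot f i).

Lemma rable_D i f h : (i <= d)%N -> rable i f -> rable i h ->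
  rable i (f + h) /\ rto i (f + h) = rto i f + rto i h.
Proof.
elim: i => // i IH id [rf Of] [rh Oh].
have [h1 h2] := IH (ltnW id) rf rh.
by have [h3 h4] := pl_D (dvr_pl (dv id)) Of Oh; rewrite /= h2.
Qed.

Lemma rable_M i f h : (i <= d)%N -> rable i f -> rable i h ->
  rable i (f * h) /\ rto i (f * h) = rto i f * rto i h.
Proof.
elim: i => // i IH id [rf Of] [rh Oh].
have [h1 h2] := IH (ltnW id) rf rh.
by have [h3 h4] := pl_M (dvr_pl (dv id)) Of Oh; rewrite /= h2.
Qed.

Lemma rable_C i c : (i <= d)%N -> rable i (iK 0%N c) /\ rto i (iK 0%N c) = iK i c.
Proof.
elim: i => // i IH id; have [h1 h2] := IH (ltnW id).
by have [h3 h4] := pl_C (dvr_pl (dv id)) c; rewrite /= h2.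
Qed.

Lemma rable_1 i : (i <= d)%N -> rable i 1 /\ rto i 1 = 1.
Proof. by move=> /(rable_C 1); rewrite !rmorph1. Qed.

Lemma rable_0 i : (i <= d)%N -> rable i 0 /\ rto i 0 = 0.
Proof. by move=> /(rable_C 0); rewrite !rmorph0. Qed.

(** For nonzero [f] this says that the first [i] coordinates of its value vanish, see
    [fval_alive]. *)
Definition alive i f := rable i f /\ rto i f != 0.

Lemma alive_neq0 i f : (i <= d)%N -> alive i f -> f != 0.
Proof. by move=> id [_]; apply: contra => /eqP ->; rewrite (rable_0 id).2. Qed.

Lemma alive_M i f h : (i <= d)%N -> alive i f -> alive i h -> alive i (f * h).
Proof.
move=> id [rf nf] [rh nh]; have [h1 h2] := rable_M id rf rh.
by split=> //; rewrite h2 mulf_neq0.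
Qed.

Lemma alive_S i f : (i < d)%N -> alive i.+1 f <-> alive i f /\ oat i f = 0.
Proof.
move=> id; split=> [[[rf Of] nf]|[[rf nf] of0]].
  have nf' := pl_neq0 (dvr_pl (dv id)) nf.
  by split=> //; apply/(dvr_eq0 (dv id) nf').
by have [Of nf'] := (dvr_eq0 (dv id) nf).1 of0.
Qed.

Lemma alive_V i f : (i <= d)%N -> alive i f -> alive i f^-1 /\ rto i f^-1 = (rto i f)^-1.
Proof.
elim: i => [|i IH] id; first by move=> [_ nf]; do 2!split=> //; rewrite /= invr_neq0.
move=> af; have [af' of0] := (alive_S f id).1 af.
have [[h1 nh] h2] := IH (ltnW id) af'.
case: af => -[rf Of] nf; have pl := dvr_pl (dv id).
rewrite /alive /= h2 (pl_resV pl Of nf) invr_eq0; do 3!split=> //.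
exact: pl_V pl _ Of nf.
Qed.

Lemma alive_Z i f (e : int) : (i <= d)%N -> alive i f ->
  alive i (f ^ e) /\ rto i (f ^ e) = rto i f ^ e.
Proof.
move=> id af; have hn h (m : nat) : alive i h ->
    alive i (h ^+ m) /\ rto i (h ^+ m) = rto i h ^+ m.
  move=> ah; elim: m => [|m [IH1 IH2]].
    have [h1 h2] := rable_1 id; rewrite !expr0.
    by split=> //; split=> //; rewrite h2 oner_neq0.
  rewrite !exprS; have [_ ->] := rable_M id ah.1 IH1.1.
  by rewrite IH2; split=> //; apply: alive_M.
case: e => m; first by rewrite -!exprnP; exact: hn.
have [aV EV] := alive_V id af.
by rewrite NegzE -!exprz_inv -!exprnP -EV; exact: hn.
Qed.

(** [g i] has order 1 at step [i], so dividing by its power leaves order 0: a unit of the local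
    ring, whose restriction is nonzero. *)
Lemma fquotP f i : f != 0 -> (i <= d)%N -> alive i (fquot f i).
Proof.
move=> f0; elim: i => // i IH id; have aq := IH (ltnW id).
have [h1 h2 h3] := hg id; have ag : alive i (g i) by [].
have [aZ EZ] := alive_Z (oat i (fquot f i)) (ltnW id) ag.
have [aV EV] := alive_V (ltnW id) aZ.
apply/(alive_S _ id) => /=; split; first exact: alive_M (ltnW id) _ _.
rewrite /oat (rable_M (ltnW id) aq.1 aV.1).2 EV EZ.
rewrite (dvrM (dv id)) ?invr_neq0 ?expfz_neq0 ?aq.2 //.
rewrite (dvrV (dv id)) ?expfz_neq0 // (dvrZ (dv id)) //.
by rewrite [ord (rto i (g i))]h3 mul1r subrr.
Qed.

Lemma fquotM f h i : f != 0 -> h != 0 -> (i <= d)%N ->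
  fquot (f * h) i = fquot f i * fquot h i.
Proof.
move=> f0 h0; elim: i => // i IH id /=; rewrite (IH (ltnW id)).
have [aq1 nq1] := fquotP f0 (ltnW id); have [aq2 nq2] := fquotP h0 (ltnW id).
rewrite {1}/oat (rable_M (ltnW id) aq1 aq2).2 (dvrM (dv id)) //.
have [h1 h2 h3] := hg id; have gi0 : g i != 0.
  by apply: (@alive_neq0 i _ (ltnW id)).
by rewrite expfzDr // invfM mulrACA.
Qed.

Lemma fvalM f h i : f != 0 -> h != 0 -> (i < d)%N ->
  fval (f * h) i = fval f i + fval h i.
Proof.
move=> f0 h0 id; rewrite /fval fquotM ?(ltnW id) // /oat.
have [aq1 nq1] := fquotP f0 (ltnW id); have [aq2 nq2] := fquotP h0 (ltnW id).
by rewrite (rable_M (ltnW id) aq1 aq2).2 (dvrM (dv id)).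
Qed.

Lemma fval1 i : (i < d)%N -> fval 1 i = 0.
Proof.
move=> id; have := fvalM (oner_neq0 _) (oner_neq0 _) id; rewrite mulr1 => E.
by apply: (addrI (fval 1 i)); rewrite addr0 -E.
Qed.

Lemma fvalV f i : f != 0 -> (i < d)%N -> fval f^-1 i = - fval f i.
Proof.
move=> f0 id; apply/eqP; rewrite -addr_eq0 addrC -fvalM ?invr_eq0 //.
rewrite mulfV //; apply/eqP; exact: fval1.
Qed.

Lemma fquot_id f i : (forall j, (j < i)%N -> fval f j = 0) -> fquot f i = f.
Proof.
elim: i => // i IH h /=; rewrite IH => [|j ji]; last by apply: h; rewrite ltnW.
have := h i (ltnSn i); rewrite /fval IH => [->|j ji]; last by apply: h; rewrite ltnW.
by rewrite expr0z divr1.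
Qed.

Lemma fval_alive f i : f != 0 -> (i <= d)%N ->
  (forall j, (j < i)%N -> fval f j = 0) <-> alive i f.
Proof.
move=> f0 id; split=> [/fquot_id E|]; first by rewrite -{1}E; exact: fquotP.
elim: i id => // i IH id /(alive_S _ id)[ai oi] j.
have h := IH (ltnW id) ai.
by rewrite ltnS leq_eqVlt => /predU1P[->|/h//]; rewrite /fval fquot_id.
Qed.

Definition lexpos (a : nat -> int) :=
  exists2 k, (k < d)%N & (forall j, (j < k)%N -> a j = 0) /\ 0 < a k.

(** All is decided at the first step with nonzero order: if that order is positive, [f] restricts to
    0 and stays 0; if it is negative, [f] cannot be restricted further. The left side describes the
    maximal ideal of the composite valuation ring. *)
Lemma rable_lexpos f : f != 0 ->
  (rable d f /\ rto d f = 0) <-> lexpos (fval f).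
Proof.
move=> f0; split=> [[rf ef]|[k kd [h0 hk]]].
  have [k kd [ak nak]] : exists2 k, (k < d)%N & alive k f /\ ~ alive k.+1 f.
    apply: contrapT => h; suff: alive d f by case; rewrite ef eqxx.
    have : (d <= d)%N by []; elim: {-2}d => [|i IH] id; first by split.
    by apply: contrapT => nai; apply: h; exists i => //; split=> //; exact: IH (ltnW id).
  exists k => //; have h0 := (fval_alive f0 (ltnW kd)).2 ak.
  split=> //; rewrite /fval (fquot_id h0) lt_neqAle eq_sym; apply/andP; split.
    by apply/eqP => o0; apply: nak; apply/alive_S.
  apply/(dvr_ge0 (dv kd) ak.2).
  have mono m : (k < m)%N -> (m <= d)%N -> rable m f -> O (rto k f).
    elim: m => // m IH; rewrite ltnS leq_eqVlt => /predU1P[<-|km] md [rm Om] //.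
    exact: IH (ltnW md) rm.
  exact: mono kd (leqnn d) rf.
have [ak1 ak2] := (fval_alive f0 (ltnW kd)).1 h0.
move: hk; rewrite /fval (fquot_id h0) => hk.
have Ok : O (rto k f) by apply/(dvr_ge0 (dv kd) ak2)/ltW.
have r0 : rto k.+1 f = 0.
  apply/eqP; case: eqVneq => // rn; exfalso.
  have := (dvr_eq0 (dv kd) ak2).2 (conj Ok rn).
  by move=> E; move: hk; rewrite /oat E.
have mono m : (k < m)%N -> (m <= d)%N -> rable m f /\ rto m f = 0.
  elim: m => // m IH; rewrite ltnS leq_eqVlt => /predU1P[<-|km] md; first by [].
  have [h1 h2] := IH km (ltnW md); have [h3 h4] := pl_0 (dvr_pl (dv md)).
  by rewrite /= h2.
exact: mono kd (leqnn d).
Qed.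

Lemma lex_tri (a : nat -> int) :
  [\/ lexpos a, (forall j, (j < d)%N -> a j = 0) | lexpos (fun j => - a j)].
Proof.
case: (pselect (forall j, (j < d)%N -> a j = 0)) => [h|]; first by constructor 2.
move=> /asboolPn/existsp_asboolPn => -[j0 hj0].
have {hj0} hj0 : (j0 < d)%N && (a j0 != 0).
  by apply/negPn/negP => h; apply: hj0 => jd; move: h; rewrite jd /= negbK => /eqP.
have [k /andP[kd ak] kmin] := ex_minnP (ex_intro (fun j => (j < d)%N && (a j != 0)) j0 hj0).
have h0 j : (j < k)%N -> a j = 0.
  move=> jk; apply/eqP; case: eqVneq => // aj; have := kmin j.
  by rewrite (ltn_trans jk kd) aj leqNgt jk => /(_ isT).
case: (ltP 0 (a k)) => hk; first by constructor 1; exists k.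
constructor 3; exists k => //; split=> [j /h0->|]; first by rewrite oppr0.
by rewrite oppr_gt0 lt_neqAle ak.
Qed.

Definition lexlt_seq (a b : nat -> int) :=
  exists2 k, (k < d)%N & (forall j, (j < k)%N -> a j = b j) /\ a k < b k.

Lemma lexlt_seqE a b : lexlt_seq a b <-> lexpos (fun j => b j - a j).
Proof.
split=> -[k kd [h0 hk]]; exists k => //; split.
- by move=> j /h0 ->; rewrite subrr.
- by rewrite subr_gt0.
- by move=> j /h0/eqP; rewrite subr_eq0 => /eqP.
- by rewrite -subr_gt0.
Qed.

Lemma lexpos_ext a b : (forall j, (j < d)%N -> a j = b j) -> lexpos a -> lexpos b.
Proof.
move=> ab [k kd [h0 hk]]; exists k => //; rewrite -ab //; split=> // j jk.
by rewrite -ab ?h0 // (ltn_trans jk).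
Qed.

Lemma fval_div f h j : f != 0 -> h != 0 -> (j < d)%N ->
  fval (h / f) j = fval h j - fval f j.
Proof. by move=> f0 h0 jd; rewrite fvalM ?invr_eq0 // fvalV. Qed.

Lemma fval_eq f h : f != 0 -> h != 0 ->
  (forall j, (j < d)%N -> fval f j = fval h j) <-> alive d (h / f).
Proof.
move=> f0 h0; have hf0 : h / f != 0 by rewrite mulf_neq0 ?invr_eq0.
rewrite -(fval_alive hf0 (leqnn d)); split=> E j jd.
  by rewrite fval_div // E // subrr.
by apply/eqP; rewrite eq_sym -subr_eq0 -fval_div // E.
Qed.

Lemma fval_lt f h : f != 0 -> h != 0 ->
  lexlt_seq (fval f) (fval h) <-> rable d (h / f) /\ rto d (h / f) = 0.
Proof.
move=> f0 h0; have hf0 : h / f != 0 by rewrite mulf_neq0 ?invr_eq0.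
rewrite lexlt_seqE rable_lexpos //.
by split; apply: lexpos_ext => j jd; rewrite fval_div.
Qed.

Definition fle f h := lexlt_seq (fval f) (fval h) \/
  (forall j, (j < d)%N -> fval f j = fval h j).

(** This turns comparison of values into membership in the composite valuation ring, so that the
    bound on the value of a sum follows from closure under addition. *)
Lemma fval_le f h : f != 0 -> h != 0 -> fle f h <-> rable d (h / f).
Proof.
move=> f0 h0; rewrite /fle fval_lt // fval_eq //; split; first by case=> [[]|[]].
move=> r; case: (eqVneq (rto d (h / f)) 0) => E; first by left.
by right.
Qed.

Lemma fle_total f h : f != 0 -> h != 0 -> fle f h \/ lexlt_seq (fval h) (fval f).
Proof.
move=> f0 h0; have [hp|hz|hn] := lex_tri (fun j => fval h j - fval f j).
- by left; left; apply/lexlt_seqE.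
- left; right => j jd; apply/eqP; rewrite eq_sym -subr_eq0; apply/eqP; exact: hz.
- right; apply/lexlt_seqE; apply: lexpos_ext hn => j jd; by rewrite opprB.
Qed.

Lemma fval_add f h : f != 0 -> h != 0 -> f + h != 0 -> fle f h -> fle f (f + h).
Proof.
move=> f0 h0 fh0 /(fval_le f0 h0) r; apply/(fval_le f0 fh0).
rewrite mulrDl mulfV //; have [r1 _] := rable_1 (leqnn d).
exact: (rable_D (leqnn d) r1 r).1.
Qed.

Lemma fval_const c i : c != 0 -> (i < d)%N -> fval (iK 0%N c) i = 0.
Proof.
move=> c0 id; have h0 : iK 0%N c != 0 by rewrite fmorph_eq0.
apply: (fval_alive h0 (leqnn d)).2 id.
by have [h1 h2] := rable_C c (leqnn d); split=> //; rewrite h2 fmorph_eq0.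
Qed.

(** [f / h] is a unit of the composite valuation ring; if [c] is its residue in [K d], which is a
    constant, then [f / h - c] lies in the maximal ideal. *)
Lemma fval_sub f h : f != 0 -> h != 0 ->
  (forall j, (j < d)%N -> fval f j = fval h j) ->
  exists2 c, c != 0 &
    f - iK 0%N c * h != 0 -> lexlt_seq (fval f) (fval (f - iK 0%N c * h)).
Proof.
move=> f0 h0 E; have E' j : (j < d)%N -> fval h j = fval f j by move/E.
have [r nr] := (fval_eq h0 f0).1 E'; have [c Ec] := last_const (rto d (f / h)).
have c0 : c != 0 by rewrite -(fmorph_eq0 (iK d)) -Ec.
exists c => // n0; suff: lexlt_seq (fval h) (fval (f - iK 0%N c * h)).
  case=> k kd [h1 h2]; exists k => //; rewrite E //; split=> // j jk.
  by rewrite E ?h1 // (ltn_trans jk).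
apply/(fval_lt h0 n0); rewrite mulrBl mulfK //.
have [h1 h2] := rable_C (- c) (leqnn d).
have [h3 h4] := rable_D (leqnn d) r h1.
by rewrite -rmorphN; split; rewrite // h4 h2 Ec rmorphN subrr.
Qed.

End Flag.

(** * Homogeneous Noether normalization *)

Section Frobenius.
Variables (F : finFieldType).
Local Notation q := #|F|.

Section InField.
Variables (L : fieldType) (i : {rmorphism F -> L}).

Lemma card_pchar_nat : exists2 p, p \in [pchar L] & p.-nat q.
Proof.
have [p pr_p pF] := finPcharP F; exists p; first exact: rmorph_pchar pF.
by have := abelem_pgroup (fin_ring_pchar_abelem pF); rewrite /pgroup cardsT.
Qed.

Lemma frobD e (x y : L) : (x + y) ^+ (q ^ e) = x ^+ (q ^ e) + y ^+ (q ^ e).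
Proof.
have [p pL pq] := card_pchar_nat.
apply: exprDn_pchar; rewrite pnatX; apply/orP; left.
by apply: sub_in_pnat pq => l _ /eqnP ->.
Qed.

Lemma frobS e e' (x : L) : x ^+ (q ^ (e + e')) = (x ^+ (q ^ e)) ^+ (q ^ e').
Proof. by rewrite expnD exprM. Qed.

Lemma frob0 e : (0 : L) ^+ (q ^ e) = 0.
Proof. by rewrite expr0n expn_eq0 (gtn_eqF (ltnW (finNzRing_gt1 F))). Qed.

Lemma frob_inj e (x y : L) : x ^+ (q ^ e) = y ^+ (q ^ e) -> x = y.
Proof.
move=> E; have := frobD e (x - y) y; rewrite subrK E => /eqP.
rewrite -subr_eq subrr eq_sym expf_eq0 => /andP[_].
by rewrite subr_eq0 => /eqP.
Qed.

Lemma frob_sum e I (r : seq I) (P : pred I) (f : I -> L) :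
  (\sum_(j <- r | P j) f j) ^+ (q ^ e) = \sum_(j <- r | P j) f j ^+ (q ^ e).
Proof. exact: (big_morph (fun x => x ^+ (q ^ e)) (frobD e) (frob0 e)). Qed.

Lemma frob_C e c : i c ^+ (q ^ e) = i c.
Proof.
rewrite -rmorphXn; congr (i _).
by elim: e => [|e IH]; rewrite ?expn0 ?expr1 // expnSr exprM IH expf_card.
Qed.

Lemma frob_mmap e r (t : 'I_r -> L) (G : {mpoly F[r]}) :
  (forall j, t j ^+ (q ^ e) = t j) -> mmap i t G ^+ (q ^ e) = mmap i t G.
Proof.
move=> ht; rewrite /mmap frob_sum; apply: eq_bigr => m _.
rewrite exprMn frob_C /mmap1 -prodrXl; congr (_ * _); apply: eq_bigr => j _.
by rewrite exprAC ht.
Qed.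

Lemma frob_horner e (P : {poly L}) y : (forall j, P`_j ^+ (q ^ e) = P`_j) ->
  P.[y] ^+ (q ^ e) = P.[y ^+ (q ^ e)].
Proof.
move=> hP; rewrite !horner_coef frob_sum; apply: eq_bigr => j _.
by rewrite exprMn hP exprAC.
Qed.

Lemma frob_iter e a (y : L) : y ^+ (q ^ e) = y -> y ^+ (q ^ (e * a)) = y.
Proof.
move=> h; elim: a => [|a IH]; first by rewrite muln0 expn0 expr1.
by rewrite mulnS frobS h IH.
Qed.

(** The iterates of [y] under the [q ^ e]-power map are roots of [P], so two of the first [size P]
    coincide. Their distance divides the factorial, and the power map is injective, so [y] itself is
    periodic. *)
Lemma frob_root e (P : {poly L}) y : (forall j, P`_j ^+ (q ^ e) = P`_j) ->
  P != 0 -> P.[y] = 0 -> y ^+ (q ^ (e * (size P)`!)) = y.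
Proof.
move=> hP P0 Py; pose z a := y ^+ (q ^ (e * a)).
have zr a : root P (z a).
  rewrite /root; elim: a => [|a IH]; first by rewrite /z muln0 expn0 expr1 Py.
  by rewrite /z mulnSr frobS -frob_horner // (eqP IH) frob0.
have : ~~ uniq [seq z a | a <- iota 0 (size P)].
  apply/negP => u; have ar : all (root P) [seq z a | a <- iota 0 (size P)].
    by apply/allP => _ /mapP[a _ ->].
  by have := max_poly_roots P0 ar u; rewrite size_map size_iota ltnn.
move/uniqPn => /(_ 0)[a [b [ab]]]; rewrite size_map size_iota => bP.
rewrite !(nth_map 0%N) ?size_iota // 1?(ltn_trans ab) //.
rewrite !nth_iota // 1?(ltn_trans ab) // !add0n /z => E.
have Eb : b = (a + (b - a))%N by rewrite subnKC // ltnW.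
rewrite Eb mulnDr addnC frobS in E; move/esym/frob_inj: E => E.
have d : ((b - a) %| (size P)`!)%N.
  by apply: dvdn_fact; rewrite subn_gt0 ab (leq_trans (leq_subr _ _)) // ltnW.
by rewrite -(divnK d) mulnCA mulnC; apply: frob_iter.
Qed.

End InField.

(* The equations t^(q^N) = t + 1 confine t to a finite field, so a large enough
   exponent in each further variable avoids the zeros of P. *)
Lemma frob_dodge r (P : {mpoly F[r]}) : P != 0 ->
  exists N : 'I_r -> nat, (forall j, (0 < N j)%N) /\
  forall (L : fieldType) (i : {rmorphism F -> L}) (t : 'I_r -> L),
    (forall j, t j ^+ (q ^ N j) = t j + 1) -> mmap i t P != 0.
Proof.
elim: r P => [|r IH] P P0.
  exists (fun _ => 1%N); split=> // L i t _.
  have [c Ec] : exists c, P = c%:MP by exists P@_0; exact: nvar0_mpolyC.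
  by rewrite Ec mmapC fmorph_eq0; move: P0; rewrite Ec mpolyC_eq0.
have mP0 : muni P != 0 by apply: contra P0 => /eqP/muni_inj ->.
(* Dodging the zeros of the leading coefficient preserves the size of the polynomial in the last
   variable, so [Nr] can be fixed before [t] is known. *)
have lc0 : lead_coef (muni P) != 0 by rewrite lead_coef_eq0.
have [N [N0 hN]] := IH _ lc0.
have [p pr_p pF] := finPcharP F.
(* [p] rounds of [t ^+ (q ^ N) = t + 1] return to [t], so [M] is a common period of the earlier
   coordinates. By [frob_root] a zero in the last coordinate would be fixed by the [q ^ Nr]-power
   map, which however adds 1 to it. *)
pose M := (p * \prod_j N j)%N.
pose Nr := (M * (size (muni P))`!)%N.
exists (fun j => if unlift ord_max j is Some j' then N j' else Nr).
have M0 : (0 < M)%N by rewrite muln_gt0 prime_gt0 //=; apply: prodn_gt0.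
split=> [j|L i t ht].
  by case: unlift => //; rewrite muln_gt0 M0 fact_gt0.
have ht1 j : t (widen_ord (leqnSn r) j) ^+ (q ^ N j) = t (widen_ord (leqnSn r) j) + 1.
  have := ht (widen_ord (leqnSn r) j).
  have -> : widen_ord (leqnSn r) j = lift ord_max j by exact/val_inj/esym/lift_max.
  by rewrite liftK.
have ht2 : t ord_max ^+ (q ^ Nr) = t ord_max + 1.
  by have := ht ord_max; rewrite unlift_none.
have hM j : t (widen_ord (leqnSn r) j) ^+ (q ^ M) = t (widen_ord (leqnSn r) j).
  set x := t _; have hx a : x ^+ (q ^ (N j * a)) = x + a%:R.
    elim: a => [|a IHa]; first by rewrite muln0 expn0 expr1 addr0.
    rewrite mulnSr frobS IHa (frobD i) ht1 -(rmorph_nat i) (frob_C i) rmorph_nat.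
    by rewrite -addrA -natr1 [1 + _]addrC.
  have -> : M = (N j * (p * \prod_(l | l != j) N l))%N.
    by rewrite /M (bigD1 j) //= mulnCA.
  by rewrite hx natrM (pcharf0 (rmorph_pchar i pF)) mul0r addr0.
rewrite mmap_muni; set Q := map_poly _ _.
have hQ l : Q`_l ^+ (q ^ M) = Q`_l by rewrite coef_map /=; exact: frob_mmap.
have Qlc := hN L i _ ht1.
have sQ : size Q = size (muni P) by apply: size_map_poly_id0.
apply/eqP => Q0; have Qn0 : Q != 0 by rewrite -size_poly_eq0 sQ size_poly_eq0.
have := frob_root i hQ Qn0 Q0; rewrite sQ -/Nr ht2 => /eqP.
by rewrite -subr_eq0 addrAC subrr add0r oner_eq0.
Qed.

End Frobenius.

Lemma rmorph_mmap (F : nzRingType) (S S' : comNzRingType) (phi : {rmorphism S -> S'}) r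
    (f : F -> S) (h : 'I_r -> S) (G : {mpoly F[r]}) :
  phi (mmap f h G) = mmap (phi \o f) (phi \o h) G.
Proof.
rewrite /mmap rmorph_sum; apply: eq_bigr => m _.
rewrite rmorphM /= /mmap1 rmorph_prod; congr (_ * _); apply: eq_bigr => j _.
by rewrite rmorphXn.
Qed.

(** * Divisibility by [X_0] *)

Section FreeVar.
Variables (F : fieldType) (r : nat).
Implicit Types G H : {mpoly F[r.+1]}.

Definition X0free G := has (fun m : 'X_{1..r.+1} => m ord0 == 0%N) (msupp G).

(** Reduction modulo [X_0]. Its kernel consists of the multiples of [X_0] and its target is a
    domain, whence the multiplicativity of [X0free]. *)
Definition X0kill : {mpoly F[r.+1]} -> {mpoly F[r.+1]} :=
  mmap (@mpolyC r.+1 F) (fun i => if i == ord0 then 0 else 'X_i).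
HB.instance Definition _ := GRing.RMorphism.on X0kill.

Lemma X0freePn G : ~~ X0free G -> exists G', G = 'X_ord0 * G'.
Proof.
move=> /hasPn h; exists (\sum_(m <- msupp G) G@_m *: 'X_[m - U_(ord0)]).
rewrite mulr_sumr {1}[G]mpolyE big_seq [RHS]big_seq; apply: eq_bigr => m mG.
by rewrite -scalerAr -mpolyXD addmC submK // lep1mP h.
Qed.

Lemma X0kill_X m : X0kill 'X_[m] = if m ord0 == 0%N then 'X_[m] else 0.
Proof.
rewrite /X0kill mmapX /mmap1; case: eqP => [m0|/eqP m0].
  rewrite [RHS]mpolyXE_id; apply: eq_bigr => i _; case: eqP => // ->.
  by rewrite m0 !expr0.
by rewrite (bigD1 ord0) //= expr0n (negPf m0) mul0r.
Qed.

Lemma X0kill_neq0 G : X0free G -> X0kill G != 0.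
Proof.
move=> /hasP[m mG m0]; suff: (X0kill G)@_m != 0.
  by apply: contra => /eqP ->; rewrite mcoeff0.
rewrite [G]mpolyE rmorph_sum raddf_sum /= (bigD1_seq m) ?msupp_uniq //=.
have h m' : (X0kill (G@_m' *: 'X_[m']))@_m =
    if (m' == m) then G@_m else 0.
  rewrite -mul_mpolyC rmorphM /=.
  have -> : X0kill (G@_m')%:MP = (G@_m')%:MP by rewrite /X0kill mmapC.
  rewrite X0kill_X mcoeffCM; case: (eqVneq m' m) => [->|ne].
    by rewrite m0 mcoeffX eqxx mulr1.
  by case: ifP => _; rewrite ?mcoeffX ?(negPf ne) ?mcoeff0 mulr0.
rewrite h eqxx big1 ?addr0 => [|m' ne]; last by rewrite h (negPf ne).
by rewrite -mcoeff_msupp.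
Qed.

Lemma X0killX : X0kill 'X_ord0 = 0.
Proof. by rewrite X0kill_X mnm1E eqxx. Qed.

Lemma X0freeP G : reflect (X0kill G != 0) (X0free G).
Proof.
apply: (iffP idP); first exact: X0kill_neq0.
by apply: contraR => /X0freePn[G' ->]; rewrite rmorphM /= X0killX mul0r.
Qed.

Lemma X0freeM G H : X0free G -> X0free H -> X0free (G * H).
Proof. by move=> /X0freeP g /X0freeP h; apply/X0freeP; rewrite rmorphM mulf_neq0. Qed.

Lemma X0free1 : X0free 1.
Proof. by apply/X0freeP; rewrite rmorph1 oner_neq0. Qed.

Lemma X0_neq0 : ('X_ord0 : {mpoly F[r.+1]}) != 0.
Proof.
suff: ('X_ord0 : {mpoly F[r.+1]})@_U_(ord0) != 0.
  by apply: contra => /eqP ->; rewrite mcoeff0.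
by rewrite mcoeffX eqxx oner_neq0.
Qed.

(** [X_0] is prime and does not divide [G], so its factors pass to [b] one at a time. This is the
    coprimality used to cancel denominators. *)
Lemma X0free_dvd G b c k : X0free G -> G * b = 'X_ord0 ^+ k * c ->
  exists b', b = 'X_ord0 ^+ k * b'.
Proof.
move=> fG; elim: k b c => [|k IH] b c E; first by exists b; rewrite expr0 mul1r.
have : ~~ X0free b.
  apply/negP => fb; have /X0freeP := X0freeM fG fb.
  by rewrite E exprS !rmorphM /= X0killX !mul0r eqxx.
case/X0freePn => b1 E1; have [b' E'] : exists b', b1 = 'X_ord0 ^+ k * b'.
  apply: (IH _ c); apply: (mulfI X0_neq0).
  by rewrite mulrCA -E1 E exprS mulrA.
by exists b'; rewrite E1 E' exprS mulrA.
Qed.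

End FreeVar.

Section Eval.
Variables (F : finFieldType) (n r : nat) (y : 'I_r -> {mpoly F[n]}).

Definition ev : {mpoly F[r]} -> {mpoly F[n]} := mmap (@mpolyC n F) y.
HB.instance Definition _ := GRing.RMorphism.on ev.

Lemma ev_C c : ev c%:MP = c%:MP. Proof. exact: mmapC. Qed.

Lemma ev_X j : ev 'X_j = y j. Proof. by rewrite /ev mmapX mmap1U. Qed.

Lemma evZ c G : ev (c *: G) = c *: ev G.
Proof. by rewrite -mul_mpolyC rmorphM /= ev_C mul_mpolyC. Qed.

Variable e : nat.
Hypothesis hy : forall j, y j \is e.-homog.

Lemma ev_homX m : ev 'X_[m] \is (e * mdeg m).-homog.
Proof.
rewrite /ev mmapX /mmap1 mdegE big_distrr /=.
elim/big_rec2: _ => [|j a b _ IH]; first exact: dhomog1.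
by apply: dhomogM IH; exact: dhomogMn (hy j).
Qed.

Lemma ev_hom k G : G \is k.-homog -> ev G \is (e * k).-homog.
Proof.
move=> /dhomogP hG; rewrite [G]mpolyE rmorph_sum; rewrite big_seq; apply: rpred_sum => m mG.
by rewrite /= evZ rpredZ //; have := ev_homX m; rewrite (hG m mG).
Qed.

Hypothesis e0 : (0 < e)%N.

(** Substituting forms of degree [e] multiplies degrees by [e]; as [e] is positive, distinct degrees
    stay distinct. *)
Lemma ev_pi k G : pihomog mdeg (e * k) (ev G) = ev (pihomog mdeg k G).
Proof.
rewrite [G]mpolyE (raddf_sum (pihomog mdeg k)) !(rmorph_sum ev).
rewrite (raddf_sum (pihomog mdeg (e * k))).
apply: eq_bigr => m _; rewrite /= evZ !linearZ /= evZ pihomogX.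
congr (_ *: _); case: eqP => [E|/eqP E].
  by rewrite pihomog_dE //; have := ev_homX m; rewrite E.
by rewrite rmorph0 (pihomog_ne0 _ (ev_homX m)) // eqn_pmul2l.
Qed.

End Eval.

(** * Affine chart of the hyperplane [X_0 = 0] *)

Section Dehomog.
Variables (F : fieldType) (r : nat).

Definition mid (j : 'I_r) : 'I_r.+2 := lift ord0 (lift ord_max j).

Definition dh (S : Type) (u0 : S) (x : 'I_r -> S) (u1 : S) (a : 'I_r.+2) : S :=
  if unlift ord0 a is Some b then
    if unlift ord_max b is Some j then x j else u1
  else u0.

Lemma dhE S (u0 : S) x u1 :
  [/\ dh u0 x u1 ord0 = u0, forall j, dh u0 x u1 (mid j) = x j &
    dh u0 x u1 ord_max = u1].
Proof.
rewrite /dh /mid; split=> [|j|]; first by rewrite unlift_none.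
  by rewrite !liftK.
have -> : (ord_max : 'I_r.+2) = lift ord0 (ord_max : 'I_r.+1) by exact: val_inj.
by rewrite liftK unlift_none.
Qed.

Lemma mid_ind (Q : 'I_r.+2 -> Prop) :
  Q ord0 -> (forall j, Q (mid j)) -> Q ord_max -> forall a, Q a.
Proof.
move=> Q0 Qm Q1 a; case: (unliftP ord0 a) => [b ->|-> //].
case: (unliftP ord_max b) => [j ->|->]; first exact: Qm.
by have -> : lift ord0 ord_max = ord_max :> 'I_r.+2 by exact: val_inj.
Qed.

Lemma big_mid (R : Type) (idx : R) (op : Monoid.com_law idx) (f : 'I_r.+2 -> R) :
  \big[op/idx]_a f a =
    op (f ord0) (op (\big[op/idx]_(j < r) f (mid j)) (f ord_max)).
Proof.
rewrite big_ord_recl; congr (op _ _); rewrite big_ord_recr /=; congr (op _ _).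
  apply: eq_bigr => j _; congr (f _); rewrite /mid; congr (lift _ _).
  exact/val_inj/esym/lift_max.
by congr (f _); exact: val_inj.
Qed.

Definition dehom (G : {mpoly F[r.+2]}) : {mpoly F[r]} :=
  mmap (@mpolyC r F) (dh 0 (fun j => 'X_j) 1) G.

Lemma mmap_dehom (S : comNzRingType) (i : {rmorphism F -> S}) (t : 'I_r -> S) G :
  mmap i t (dehom G) = mmap i (dh 0 t 1) G.
Proof.
rewrite /dehom (rmorph_mmap (mmap i t)) /mmap; apply: eq_bigr => m _.
rewrite /= mmapC; congr (_ * _); apply: mmap1_eq => a /=.
have [e0 em e1] := dhE (0 : S) t 1.
have [e0' em' e1'] := dhE (0 : {mpoly F[r]}) (fun j => 'X_j) 1.
elim/mid_ind: a => [|j|]; rewrite ?e0 ?e0' ?rmorph0 ?em ?em' ?e1 ?e1' ?rmorph1 //.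
by rewrite mmapX mmap1U.
Qed.

Lemma mmap_homog (S : comNzRingType) (i : {rmorphism F -> S}) s (x : 'I_s -> S) c k G :
  G \is k.-homog -> mmap i (fun a => c * x a) G = c ^+ k * mmap i x G.
Proof.
move=> /dhomogP hG; rewrite /mmap mulr_sumr !big_seq; apply: eq_bigr => m mG.
rewrite mulrCA; congr (_ * _); rewrite /mmap1 -(hG m mG) /= mdegE.
under eq_bigr => a _ do rewrite exprMn.
by rewrite big_split /= expr_sum.
Qed.

(** The exponent of the last variable is determined by the others through the degree, so the
    monomials of [G] free of [X_0] stay distinct and cannot cancel. *)
Lemma dehom_neq0 k G : G \is k.-homog -> X0free G -> dehom G != 0.
Proof.
move=> /dhomogP hG /hasP[m mG m0].
pose mm (m' : 'X_{1..r.+2}) := [multinom m' (mid j) | j < r].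
suff: (dehom G)@_(mm m) != 0 by apply: contra => /eqP ->; rewrite mcoeff0.
have h m' : m' \in msupp G ->
    ((G@_m')%:MP * mmap1 (dh 0 (fun j => 'X_j) 1) m')@_(mm m) =
    if m' == m then G@_m else 0 :> F.
  move=> m'G; rewrite mcoeffCM /mmap1 big_mid /=.
  have [-> em ->] := dhE (0 : {mpoly F[r]}) (fun j => 'X_j) 1.
  rewrite expr1n mulr1; under eq_bigr => j _ do rewrite em.
  have -> : \prod_(j < r) 'X_j ^+ m' (mid j) = 'X_[mm m'] :> {mpoly F[r]}.
    by rewrite [RHS]mpolyXE_id; apply: eq_bigr => j _; rewrite mnmE.
  case: (eqVneq m' m) => [->|ne]; first by rewrite (eqP m0) expr0 mul1r mcoeffX eqxx mulr1.
  case: (eqVneq (m' ord0) 0%N) => m0'; last by rewrite expr0n (negPf m0') mul0r mcoeff0 mulr0.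
  rewrite m0' expr0 mul1r mcoeffX; case: eqP => [E|_]; last by rewrite mulr0.
  case/eqP: ne; have Em j : m' (mid j) = m (mid j).
    by have := congr1 (fun s : 'X_{1..r} => s j) E; rewrite !mnmE.
  have := hG m mG; rewrite -(hG m' m'G) /= !mdegE !big_mid /= (eqP m0) m0' !add0n.
  under eq_bigr => j _ do rewrite -Em.
  move/addnI => E1; apply/mnmP; elim/mid_ind => //.
  by rewrite (eqP m0) m0'.
rewrite /dehom /mmap raddf_sum /= big_seq (eq_bigr _ h) -big_seq.
rewrite (bigD1_seq m) ?msupp_uniq //= eqxx big1 ?addr0 => [|m' /negPf -> //].
by rewrite -mcoeff_msupp.
Qed.

End Dehomog.

(** The relation is the homogenization of [t ^+ N = t + 1], with [t = a / u]. *)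
Lemma twist_eq0 (L : fieldType) (a u : L) N : (1 < N)%N -> u = 0 ->
  a ^+ N = a * u ^+ N.-1 + u ^+ N -> a = 0.
Proof.
case: N => [|[|N]] // _ ->; rewrite !expr0n /= mulr0 addr0 => /eqP.
by rewrite expf_eq0 => /andP[_ /eqP].
Qed.

Lemma twist_div (L : fieldType) (a u : L) N : (0 < N)%N -> u != 0 ->
  a ^+ N = a * u ^+ N.-1 + u ^+ N -> (a / u) ^+ N = a / u + 1.
Proof.
case: N => // N _ nu E; rewrite expr_div_n E mulrDl mulfV ?expf_neq0 //.
by rewrite exprS -mulf_div mulfV ?expf_neq0 // mulr1.
Qed.

Section Noether.
Variables (F : finFieldType) (n : nat) (V : projvar F n).
Local Notation q := #|F|.

Lemma tofr_ev Q r (y : 'I_r -> {mpoly F[n.+1]}) G :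
  tofr Q (ev y G) = mmap (tofr Q \o @mpolyC n.+1 F) (fun j => tofr Q (y j)) G.
Proof. exact: (rmorph_mmap (tofr Q)). Qed.

(** Forms without common zero on [V], possibly dependent; their equal degrees make [ev y] carry
    forms to forms. *)
Definition hsop e r (y : 'I_r.+1 -> {mpoly F[n.+1]}) :=
  (forall j, y j \is e.-homog) /\
  forall Q, vsub Q V -> exists j, y j \notin hideal Q.

Lemma ev_homog_mem e r (y : 'I_r -> {mpoly F[n.+1]}) Q k G : (0 < e)%N ->
  (forall j, y j \is e.-homog) -> ev y G \in hideal Q ->
  ev y (pihomog mdeg k G) \in hideal Q.
Proof. by move=> e0 hy GQ; rewrite -(ev_pi hy e0) hideal_homog. Qed.

(** Components of a relation are relations, and factors [X_0] can be cancelled since [hideal V] is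
    prime and does not contain [y ord0]. *)
Lemma rel_min e r (y : 'I_r.+1 -> {mpoly F[n.+1]}) G : (0 < e)%N ->
  (forall j, y j \is e.-homog) -> y ord0 \notin hideal V ->
  G != 0 -> ev y G \in hideal V ->
  exists k G', [/\ G' \is k.-homog, X0free G' & ev y G' \in hideal V].
Proof.
move=> e0 hy ny G0 GV.
have [k Gk0] : exists k, pihomog mdeg k G != 0.
  apply: contrapT => h; move/eqP: G0; apply.
  rewrite (pihomog_partitionE (leqnn (mmeasure mdeg G))) big1 // => i _.
  by apply/eqP; case: eqVneq => // ne; case: h; exists i.
have := pihomogP mdeg k G; have := ev_homog_mem k e0 hy GV.
move: (pihomog mdeg k G) Gk0 => {G0 GV} {}G.
elim: k G => [|k IH] G G0 GV hG.
  exists 0%N, G; split=> //; apply/negPn/negP => /X0freePn[G' E].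
  move/eqP: G0; apply; rewrite -(pihomog_dE hG) E mulrC.
  by apply: (@pihomogMr_lt _ _ _ 1) => //; rewrite dhomogX /= mdeg1.
case: (boolP (X0free G)) => [fG|/X0freePn[G' E]]; first by exists k.+1, G.
have E1 : G = pihomog mdeg k G' * 'X_ord0.
  have h1 : ('X_ord0 : {mpoly F[r.+1]}) \is 1.-homog by rewrite dhomogX /= mdeg1.
  by have := pihomogMr k G' h1; rewrite addn1 => <-; rewrite -(pihomog_dE hG) E mulrC.
apply: (IH (pihomog mdeg k G')).
- by apply: contra G0 => /eqP G0'; rewrite E1 G0' mul0r.
- by move: GV; rewrite E1 rmorphM /= ev_X prime_idealrM (negPf ny) orbF.
- exact: pihomogP.
Qed.

(** The last form [u] is dropped and the middle ones are twisted by it. At a common zero of the new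
    forms [y ord0] vanishes. If [u] vanishes too, so do the middle forms; otherwise their quotients
    by [u] satisfy [t ^+ (q ^ N) = t + 1] and are a zero of the dehomogenized relation, which
    [frob_dodge] excludes. *)
Lemma NN_step e r (y : 'I_r.+1 -> {mpoly F[n.+1]}) G : (0 < e)%N ->
  hsop e y -> y ord0 \notin hideal V -> G != 0 -> ev y G \in hideal V ->
  exists r' e' (y' : 'I_r'.+1 -> {mpoly F[n.+1]}) c,
    [/\ (r' < r)%N, (0 < e')%N, (0 < c)%N, hsop e' y' & y' ord0 = y ord0 ^+ c].
Proof.
move=> e0 [hy Ey] ny G0 GV.
have {G G0 GV} [k [G [hG fG GV]]] := rel_min e0 hy ny G0 GV.
have q1 := finNzRing_gt1 F.
(* With [y ord0] alone, a form free of [X_0] is a nonzero constant, hence no relation. *)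
case: r => [|r] in y hy Ey ny G hG fG GV *.
  exfalso; case/hasP: fG => m mG /eqP m0.
  have k0 : k = 0%N by have /dhomogP/(_ m mG) <- := hG; rewrite /= mdegE big_ord1.
  have s1 : (msize G <= 1)%N by have := homog_size_le hG; rewrite k0.
  have G0 : G != 0 by rewrite -msupp_eq0; case: (msupp G) mG.
  move: GV; rewrite (msize1_polyC s1) ev_C; apply/negP/tofrC.
  by apply: contra G0; rewrite (msize1_polyC s1) mcoeffC eqxx mulr1 => /eqP ->.
have [N [N0 hN]] := frob_dodge (dehom_neq0 hG fG).
(* [M] is a common bound: raising [w j] to the power [q ^ (M - N j)] gives all new forms the degree
   [e * q ^ M]. *)
pose M := (\sum_j N j)%N.
have NM j : (N j <= M)%N by rewrite /M (bigD1 j) //= leq_addr.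
have qN j : (1 < q ^ N j)%N by rewrite -{1}(expn0 q) ltn_exp2l.
have qM : (0 < q ^ M)%N by rewrite expn_gt0 ltnW.
pose u := y ord_max.
pose w j := y (mid j) ^+ (q ^ N j) - y (mid j) * u ^+ (q ^ N j).-1 - u ^+ (q ^ N j).
have hw j : w j \is (e * q ^ N j).-homog.
  apply: rpredB; last by apply: dhomogMn; exact: hy.
  apply: rpredB; first by apply: dhomogMn; exact: hy.
  have -> : (e * q ^ N j = e + e * (q ^ N j).-1)%N.
    by rewrite -mulnS prednK // ltnW.
  by apply: dhomogM; [exact: hy | apply: dhomogMn; exact: hy].
pose y' (b : 'I_r.+1) := if unlift ord0 b is Some j then
  w j ^+ (q ^ (M - N j)) else y ord0 ^+ (q ^ M).
exists r, (e * q ^ M)%N, y', (q ^ M)%N; split=> //.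
- by rewrite muln_gt0 e0.
- split=> [b|Q QV].
    rewrite /y'; case: unlift => [j|]; last by apply: dhomogMn; exact: hy.
    have -> : (e * q ^ M = e * q ^ N j * q ^ (M - N j))%N.
      by rewrite -mulnA -expnD subnKC.
    by apply: dhomogMn; exact: hw.
  apply: contrapT => h.
  have y'Q b : tofr Q (y' b) = 0.
    by apply/eqP; rewrite tofr_eq0; apply/negPn/negP => nb; apply: h; exists b.
  have t0 : tofr Q (y ord0) = 0.
    have := y'Q ord0; rewrite /y' unlift_none rmorphXn /= => /eqP.
    by rewrite expf_eq0 => /andP[_ /eqP].
  have tw j : tofr Q (w j) = 0.
    have := y'Q (lift ord0 j); rewrite /y' liftK rmorphXn /= => /eqP.
    by rewrite expf_eq0 => /andP[_ /eqP].
  have [a na] := Ey Q QV; move: na; rewrite -tofr_eq0 => /eqP; apply.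
  have Ew j : tofr Q (y (mid j)) ^+ (q ^ N j) =
      tofr Q (y (mid j)) * tofr Q u ^+ (q ^ N j).-1 + tofr Q u ^+ (q ^ N j).
    have := tw j; rewrite /w !rmorphB !rmorphM !rmorphXn /= => /eqP.
    by rewrite subr_eq0 subr_eq addrC => /eqP.
  case: (eqVneq (tofr Q u) 0) => [u0|nu].
    by elim/mid_ind: a => // j; exact: twist_eq0 (qN j) u0 (Ew j).
  pose t j := tofr Q (y (mid j)) / tofr Q u.
  have Et a' : tofr Q (y a') = tofr Q u * dh 0 t 1 a'.
    have [d0 dm d1] := dhE (0 : crfrac Q) t 1.
    elim/mid_ind: a' => [|j|].
    - by rewrite d0 t0 mulr0.
    - by rewrite dm /t mulrC divfK.
    - by rewrite d1 mulr1.
  have ht j : t j ^+ (q ^ N j) = t j + 1.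
    exact: twist_div (ltnW (qN j)) nu (Ew j).
  have := hN _ (tofr Q \o @mpolyC n.+1 F) t ht; rewrite mmap_dehom.
  have GQ := QV _ GV; move: GQ; rewrite -tofr_eq0 tofr_ev.
  have -> : (fun j => tofr Q (y j)) = (fun a => tofr Q u * dh 0 t 1 a) by exact: funext.
  rewrite (mmap_homog _ _ _ hG) mulf_eq0 expf_eq0 (negPf nu) andbF /=.
  by move=> /eqP ->; rewrite eqxx.
- by rewrite /y' unlift_none.
Qed.

(** The start is [s] with the [e]-th powers of the coordinates; as long as a relation remains,
    [NN_step] lowers the number of forms and replaces the first by a power of itself. *)
Lemma noether_norm e s : (0 < e)%N -> s \is e.-homog -> s \notin hideal V ->
  exists r e' (y : 'I_r.+1 -> {mpoly F[n.+1]}) c,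
    [/\ (0 < e')%N, (0 < c)%N, hsop e' y, y ord0 = s ^+ c &
      forall G, ev y G \in hideal V -> G = 0].
Proof.
move=> e0 hs ns.
have start : exists r e' (y : 'I_r.+1 -> {mpoly F[n.+1]}) c,
    [/\ (0 < e')%N, (0 < c)%N, hsop e' y & y ord0 = s ^+ c].
  pose y (a : 'I_n.+2) := if unlift ord0 a is Some i then 'X_i ^+ e else s.
  exists n.+1, e, y, 1%N; split=> //; last by rewrite /y unlift_none.
  split=> [a|Q QV].
    rewrite /y; case: unlift => // i; rewrite -[e in e.-homog]mul1n.
    by apply: dhomogMn; rewrite dhomogX /= mdeg1.
  have [i ni] := hideal_relevant Q; exists (lift ord0 i); rewrite /y liftK.
  by rewrite -tofr_eq0 rmorphXn /= expf_neq0 // tofr_eq0.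
have [r0 start0] := start; elim/ltn_ind: r0 start0 => r IH [e' [y [c [e'0 c0 hy Ey]]]].
case: (pselect (forall G, ev y G \in hideal V -> G = 0)) => [ind|].
  by exists r, e', y, c.
move=> nind; have [G [GV G0]] : exists G, ev y G \in hideal V /\ G != 0.
  apply: contrapT => h; apply: nind => G GV; apply/eqP.
  by case: eqVneq => // G0; case: h; exists G.
have ny : y ord0 \notin hideal V.
  by rewrite Ey -tofr_eq0 rmorphXn /= expf_neq0 // tofr_eq0.
have [r' [e2 [y2 [c2 [rr e20 c20 hy2 Ey2]]]]] := NN_step e'0 hy ny G0 GV.
apply: (IH r' rr); exists e2, y2, (c * c2)%N; split=> //.
  by rewrite muln_gt0 c0.
by rewrite Ey2 Ey exprM.
Qed.

End Noether.

(** * Finiteness of functions with bounded poles *)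

Section FiniteOver.
Variables (F : finFieldType) (n : nat) (V : projvar F n).
Variables (e r : nat) (y : 'I_r.+1 -> {mpoly F[n.+1]}).
Hypotheses (e0 : (0 < e)%N) (hy : hsop V e y).
Let hyh : forall j, y j \is e.-homog := hy.1.

Lemma ideal_hidl (Q : projvar F n) : hideal_pred (fun p => p \in hideal Q).
Proof.
split=> [|p q hp hq|p q hq|k p hp]; first exact: rpred0.
- exact: rpredD.
- exact: idealMr.
- exact: hideal_homog.
Qed.

Lemma hsop_ideal : hideal_pred (fun p => exists u (v : 'I_r.+1 -> {mpoly F[n.+1]}),
  u \in hideal V /\ p = u + \sum_j v j * y j).
Proof.
split.
- exists 0, (fun=> 0); split; first exact: rpred0.
  by rewrite big1 ?addr0 // => j _; rewrite mul0r.
- move=> p q [u [v [hu ->]]] [u' [v' [hu' ->]]].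
  exists (u + u'), (fun j => v j + v' j); split; first exact: rpredD.
  by rewrite addrACA -big_split; congr (_ + _); apply: eq_bigr => j _; rewrite mulrDl.
- move=> p q [u [v [hu ->]]]; exists (p * u), (fun j => p * v j).
  split; first exact: idealMr.
  by rewrite mulrDr mulr_sumr; congr (_ + _); apply: eq_bigr => j _; rewrite mulrA.
- move=> k p [u [v [hu ->]]].
  exists (pihomog mdeg k u),
    (fun j => if (k < e)%N then 0 else pihomog mdeg (k - e) (v j)).
  split; first exact: hideal_homog.
  rewrite (raddfD (pihomog mdeg k)) (raddf_sum (pihomog mdeg k)) /=.
  congr (_ + _); apply: eq_bigr => j _; case: ltnP => ke.
    by rewrite (pihomogMr_lt _ (hyh j) ke) mul0r.
  by rewrite -(pihomogMr _ _ (hyh j)) subnK.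
Qed.

Lemma X_homog s (i : 'I_s) : ('X_i : {mpoly F[s]}) \is 1.-homog.
Proof. by rewrite dhomogX /= mdeg1. Qed.

Lemma Xn_homog s (i : 'I_s) k : ('X_i ^+ k : {mpoly F[s]}) \is k.-homog.
Proof. by rewrite -{2}[k]mul1n; apply: dhomogMn; exact: X_homog. Qed.

(** Otherwise a homogeneous prime containing [hideal V] and all [y j] would avoid the powers of
    ['X_i], giving a common zero of the [y j] on [V]. *)
Lemma X_nilpotent i : exists k u (v : 'I_r.+1 -> {mpoly F[n.+1]}),
  u \in hideal V /\ 'X_i ^+ k = u + \sum_j v j * y j.
Proof.
apply: contrapT => h.
have [] := exists_projvar (M := fun p => exists k, p = 'X_i ^+ k) hsop_ideal.
- by exists 0%N; rewrite expr0.
- by move=> p q [k ->] [k' ->]; exists (k + k')%N; rewrite exprD.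
- by move=> p [k ->]; exists k; exact: Xn_homog.
- by exists 1%N, 'X_i; split=> //; [exists 1%N; rewrite expr1 | exact: X_homog].
- by move=> p [u [v [hu Ep]]] [k Ek]; apply: h; exists k, u, v; rewrite -Ek.
move=> Q [JQ _]; have QV : vsub Q V.
  move=> p hp; apply: JQ; exists p, (fun=> 0); split=> //.
  by rewrite big1 ?addr0 // => j _; rewrite mul0r.
have [j /negP] := hy.2 Q QV; apply; apply: JQ; exists 0, (fun j' => (j' == j)%:R).
split; first exact: rpred0.
by rewrite add0r (bigD1 j) //= eqxx mul1r big1 ?addr0 // => j' /negPf ->; rewrite mul0r.
Qed.

Definition psi : {mpoly F[r.+1]} -> crfrac V := tofr V \o ev y.
HB.instance Definition _ := GRing.RMorphism.on psi.

(** A monomial of degree at least [b] contains some ['X_i ^+ k], which modulo [hideal V] is a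
    combination of the [y j] with coefficients of degree [k - e]; this rewriting lowers the degree
    of the monomial by [e]. *)
Lemma finite_span : exists2 b, (0 < b)%N & forall p,
  exists G : 'X_{1..n.+1 < b} -> {mpoly F[r.+1]},
    tofr V p = \sum_m psi (G m) * tofr V 'X_[m].
Proof.
have [kf hk] : exists kf : 'I_n.+1 -> nat, forall i,
    exists u (v : 'I_r.+1 -> {mpoly F[n.+1]}),
    u \in hideal V /\ 'X_i ^+ (kf i) = u + \sum_j v j * y j.
  by have /boolp.choice[kf hkf] := X_nilpotent; exists kf.
pose k := (e + \sum_i kf i)%N.
have ke : (e <= k)%N by exact: leq_addr.
have Xk i : exists v : 'I_r.+1 -> {mpoly F[n.+1]},
    (forall j, v j \is (k - e).-homog) /\
    tofr V ('X_i ^+ k) = \sum_j tofr V (v j * y j).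
  have [u [v [hu Ev]]] := hk i; have ki : (kf i <= k)%N.
    by rewrite /k (bigD1 i) //= addnCA leq_addr.
  have := hidlM hsop_ideal ('X_i ^+ (k - kf i)) (ex_intro _ u (ex_intro _ v (conj hu Ev))).
  rewrite -exprD subnK // => -[u' [v' [hu' E]]].
  exists (fun j => pihomog mdeg (k - e) (v' j)); split=> [j|]; first exact: pihomogP.
  rewrite -(pihomog_dE (Xn_homog i k)) E (raddfD (pihomog mdeg k)).
  rewrite (raddf_sum (pihomog mdeg k)) rmorphD /=.
  have /eqP h0 : tofr V (pihomog mdeg k u') == 0 by rewrite tofr_eq0 hideal_homog.
  rewrite h0 add0r (rmorph_sum (tofr V)) /=.
  apply: eq_bigr => j _; rewrite -(pihomogMr _ _ (hyh j)).
  by rewrite subnK.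
pose b := (n.+1 * k).+1; exists b => //.
pose Sp p := exists G : 'X_{1..n.+1 < b} -> {mpoly F[r.+1]},
    tofr V p = \sum_m psi (G m) * tofr V 'X_[m].
have Sp0 : Sp 0.
  by exists (fun=> 0); rewrite rmorph0 big1 // => m _; rewrite rmorph0 mul0r.
have SpD p q : Sp p -> Sp q -> Sp (p + q).
  move=> [G EG] [H EH]; exists (fun m => G m + H m); rewrite rmorphD /= EG EH.
  by rewrite -big_split; apply: eq_bigr => m _; rewrite rmorphD mulrDl.
have SpM H p : Sp p -> Sp (ev y H * p).
  move=> [G EG]; exists (fun m => H * G m); rewrite rmorphM /= EG mulr_sumr.
  by apply: eq_bigr => m _; rewrite mulrA [psi (H * _)]rmorphM.
have Sp_sum I (s : seq I) (P : pred I) f : (forall i, P i -> Sp (f i)) ->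
    Sp (\sum_(i <- s | P i) f i).
  by move=> hf; elim/big_ind: _.
have SpX m : Sp 'X_[m].
  have [N leN] := ubnP (mdeg m); elim: N m leN => // N IH m leN.
  case: (ltnP (mdeg m) b) => mb.
    exists (fun m' => if m' == BMultinom mb then 1 else 0).
    rewrite (bigD1 (BMultinom mb)) //= eqxx rmorph1 mul1r big1 ?addr0 //.
    by move=> m' /negPf ->; rewrite rmorph0 mul0r.
  have [i mi] : exists i, (k <= m i)%N.
    apply/existsP; apply: contraLR mb; rewrite negb_exists => /forallP h.
    rewrite -ltnNge ltnS mdegE -[X in (X * _)%N]card_ord -sum_nat_const.
    by apply: leq_sum => i _; apply: ltnW; rewrite ltnNge.
  have [v [hv Ev]] := Xk i; pose m' := (m - U_(i) *+ k)%MM.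
  have Em : m = (m' + U_(i) *+ k)%MM.
    rewrite /m' submK //; apply/mnm_lepP => l; rewrite mulmnE mnm1E.
    by case: eqP => [<-|_]; rewrite ?mul1n // mul0n.
  have dm' : mdeg m = (mdeg m' + k)%N by rewrite {1}Em mdegD mdegMn mdeg1 mul1n.
  suff [G EG] : Sp (\sum_j ev y 'X_j * ('X_[m'] * v j)).
    exists G; rewrite -EG {1}Em mpolyXD -mpolyXn rmorphM /= Ev mulr_sumr rmorph_sum.
    by apply: eq_bigr => j _; rewrite /= ev_X !rmorphM /= [LHS]mulrA [LHS]mulrC.
  apply: (Sp_sum) => j _; apply: (SpM); rewrite [v j]mpolyE mulr_sumr big_seq.
  apply: (Sp_sum) => m1 m1v; rewrite -scalerAr -mpolyXD -mul_mpolyC -(ev_C y).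
  apply: (SpM); apply: IH; rewrite mdegD.
  have /dhomogP/(_ _ m1v) /= -> := hv j.
  by move: leN dm' e0 ke; clear; lia.
move=> p; suff: Sp p by [].
rewrite [p]mpolyE; apply: (Sp_sum) => m _.
by rewrite -mul_mpolyC -(ev_C y); apply: (SpM); exact: SpX.
Qed.

End FiniteOver.

(* Cayley-Hamilton for multiplication by x on a finitely generated module. *)
Lemma integral_of_span (A : comNzRingType) (L : fieldType) (f : {rmorphism A -> L})
    (T : finType) (c : T -> L) (x : L) :
  (exists t, c t != 0) ->
  (forall t, exists a : T -> A, x * c t = \sum_t' f (a t') * c t') ->
  exists2 chi : {poly A}, chi \is monic & root (map_poly f chi) x.
Proof.
move=> [t0 ct0] /boolp.choice[a Ea].
(* Eigenvectors are rows, hence the exchanged indices. *)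
pose M : 'M[A]_#|T| := \matrix_(i, j) a (enum_val j) (enum_val i).
exists (char_poly M); first exact: char_poly_monic.
rewrite map_char_poly -eigenvalue_root_char; apply/eigenvalueP.
exists (\row_i c (enum_val i)).
  apply/rowP => j; rewrite !mxE Ea.
  transitivity (\sum_(t' in T) f (a (enum_val j) t') * c t'); last exact: eq_bigl.
  by rewrite [RHS]big_enum_val; apply: eq_bigr => i _; rewrite !mxE mulrC.
apply: contra ct0 => /eqP/rowP/(_ (enum_rank t0)).
by rewrite !mxE enum_rankK => /eqP.
Qed.

(** * Ideals of denominators *)

Section Denominators.
Variables (F : finFieldType) (n : nat) (V : projvar F n).
Implicit Types (Q W : projvar F n) (h : funfield V).

Definition den h u := exists w, tofr V u * ffval h = tofr V w.

(** For components: [h] has degree 0, so it carries each component of [u] to the component of [w] of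
    the same degree. This is read off [u * p = w * q] on [V], where [h = p / q] with forms of equal
    degree. *)
Lemma den_hidl h : hideal_pred (den h).
Proof.
have [e [p [q [hp hq nq E]]]] := ffvalP h.
split.
- by exists 0; rewrite rmorph0 mul0r.
- by move=> u v [w Ew] [w' Ew']; exists (w + w'); rewrite !rmorphD mulrDl /= Ew Ew'.
- by move=> u v [w Ew]; exists (u * w); rewrite !rmorphM /= -Ew mulrA.
move=> k u [w Ew]; exists (pihomog mdeg k w).
have nq' := tofr_neq0 nq; rewrite E mulrA.
have Euw : u * p - w * q \in hideal V.
  rewrite -tofr_eq0 rmorphB !rmorphM /= -Ew E.
  by rewrite mulrA mulfVK // subrr.
have := hideal_homog Euw (k + e).
rewrite (raddfB (pihomog mdeg (k + e))) /= !pihomogMr // -tofr_eq0.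
by rewrite rmorphB !rmorphM /= subr_eq0 => /eqP ->; rewrite mulfK.
Qed.

Lemma den_ideal h u : u \in hideal V -> den h u.
Proof. by rewrite -tofr_eq0 => /eqP E; exists 0; rewrite E mul0r rmorph0. Qed.

Lemma den_locring Q h : vsub Q V -> locring Q h ->
  exists2 u, u \notin hideal Q & den h u.
Proof.
move=> QV [e [p [q [hp hq nq E]]]]; exists q => //; exists p.
by rewrite E mulrC divfK // tofr_neq0 // (notin_vsub QV).
Qed.

Definition regular_off W h := forall Q, vsub Q V -> ~ vsub Q W -> locring Q h.

(** A prime containing the denominators of [h] and no power of [s] is a point of [V] off [W]; [h] is
    regular there, so some denominator lies outside the prime. *)
Lemma den_power W h e s : regular_off W h -> (0 < e)%N -> s \is e.-homog ->
  s \in hideal W -> exists k, den h (s ^+ k).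
Proof.
move=> reg e0 hs sW; apply: contrapT => nk.
have [] := exists_projvar (M := fun p => exists k, p = s ^+ k) (den_hidl h).
- by exists 0%N; rewrite expr0.
- by move=> p q [k ->] [k' ->]; exists (k + k')%N; rewrite exprD.
- by move=> p [k ->]; exists (e * k)%N; apply: dhomogMn.
- by exists e, s; split=> //; exists 1%N; rewrite expr1.
- by move=> p dp [k Ek]; apply: nk; exists k; rewrite -Ek.
move=> Q [JQ MQ]; have QV : vsub Q V by move=> p /den_ideal/JQ.
have nQW : ~ vsub Q W.
  by move=> QW; have := MQ s (ex_intro _ 1%N (esym (expr1 s))); rewrite QW.
have [u /negP nu du] := den_locring QV (reg Q QV nQW).
by apply: nu; exact: JQ.
Qed.

End Denominators.

(** * Denominators over a finitely generated module *)

Section ClearDenominators.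
Variables (A : idomainType) (L : fieldType) (f : {rmorphism A -> L}).
Variables (T : finType) (c : T -> L).
Hypothesis f_inj : injective f.

Definition lin_indep (C : {set T}) := forall a : T -> A,
  \sum_(t in C) f (a t) * c t = 0 -> forall t, t \in C -> a t = 0.

(** [C] is an independent set of maximal size; a relation created by adding [t] has a nonzero
    coefficient at [t], which is [delta]. *)
Lemma max_lin_indep : exists C, lin_indep C /\
  forall t, exists2 delta, delta != 0 & exists a : T -> A,
    f delta * c t = \sum_(t' in C) f (a t') * c t'.
Proof.
have ex0 : exists k, `[< exists C, lin_indep C /\ #|C| = k >].
  exists 0%N; apply/asboolP; exists set0; split; last exact: cards0.
  by move=> a _ t; rewrite inE.
have ub k : `[< exists C, lin_indep C /\ #|C| = k >] -> (k <= #|T|)%N.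
  by move=> /asboolP[C [_ <-]]; exact: max_card.
case: (ex_maxnP ex0 ub) => k /asboolP[C [indC Ck]] kmax.
exists C; split=> // t; case: (boolP (t \in C)) => tC.
  exists 1; first exact: oner_neq0.
  exists (fun t' => (t' == t)%:R); rewrite (bigD1 t) //= eqxx big1 ?addr0 //.
  by move=> t' /andP[_ /negPf ->]; rewrite rmorph0 mul0r.
have : ~ lin_indep (t |: C).
  move=> h; suff: (k.+1 <= k)%N by rewrite ltnn.
  by apply: kmax; apply/asboolP; exists (t |: C); rewrite cardsU1 tC Ck.
move=> nind; have [a [Ea [t1 [t1C at1]]]] : exists a, \sum_(t' in t |: C) f (a t') * c t' = 0 /\
    exists t1, t1 \in t |: C /\ a t1 != 0.
  apply: contrapT => h; apply: nind => a Ea t1 t1C; apply/eqP.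
  by case: eqVneq => // at1; case: h; exists a; split; [exact: Ea | exists t1; split].
move: Ea; rewrite big_setU1 //= => Ea.
have at0 : a t != 0.
  apply: contra at1 => /eqP at0; move: Ea; rewrite at0 rmorph0 mul0r add0r => /(indC a) h.
  by case/setU1P: t1C => [->|/h ->] //; rewrite at0.
exists (a t) => //; exists (fun t' => - a t').
apply/eqP; rewrite -subr_eq0 -sumrN; rewrite -[X in _ == X]Ea; apply/eqP.
by congr (_ + _); apply: eq_bigr => t' _; rewrite rmorphN mulNr opprK.
Qed.

Lemma clear_denominators : exists C delta, [/\ lin_indep C, delta != 0 &
  forall a : T -> A, exists b : T -> A,
    f delta * (\sum_t f (a t) * c t) = \sum_(t in C) f (b t) * c t].
Proof.
have [C [indC hC]] := max_lin_indep.
have /boolp.choice[dl hdl] : forall t, exists delta, delta != 0 /\ exists a : T -> A,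
    f delta * c t = \sum_(t' in C) f (a t') * c t'.
  by move=> t; have [delta d0 h] := hC t; exists delta.
have hd t : exists a : T -> A,
    f (\prod_t dl t) * c t = \sum_(t' in C) f (a t') * c t'.
  have [_ [a Ea]] := hdl t; exists (fun t' => (\prod_(i | i != t) dl i) * a t').
  rewrite (bigD1 t) //= [dl t * _]mulrC rmorphM -mulrA.
  by rewrite Ea mulr_sumr; apply: eq_bigr => t' _; rewrite rmorphM mulrA.
have /boolp.choice[g Eg] := hd.
exists C, (\prod_t dl t); split=> //.
  by apply/prodf_neq0 => t _; have [] := hdl t.
move=> a; exists (fun t' => \sum_t a t * g t t').
rewrite mulr_sumr (eq_bigr (fun t => \sum_(t' in C) f (a t) * (f (g t t') * c t'))).
  2: by move=> t _; rewrite mulrCA Eg mulr_sumr.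
rewrite exchange_big /=; apply: eq_bigr => t' _.
by rewrite rmorph_sum mulr_suml; apply: eq_bigr => t _; rewrite rmorphM mulrA.
Qed.

(* An element with two coprime denominators has no denominator beyond delta. *)
Lemma clear_coprime C delta x u z : lin_indep C ->
  (forall a : T -> A, exists b : T -> A,
    f delta * (\sum_t f (a t) * c t) = \sum_(t in C) f (b t) * c t) ->
  x != 0 -> (forall b c', u * b = x * c' -> exists b', b = x * b') ->
  (exists a : T -> A, f x * z = \sum_t f (a t) * c t) ->
  (exists a : T -> A, f u * z = \sum_t f (a t) * c t) ->
  exists b : T -> A, f delta * z = \sum_(t in C) f (b t) * c t.
Proof.
move=> indC hC x0 xu [a1 E1] [a2 E2].
have fx0 : f x != 0 by rewrite -(rmorph0 f) (inj_eq f_inj).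
have [b1 B1] := hC a1; have [b2 B2] := hC a2.
(* Two expansions of one element over the independent set [C] give [u * b1 t = x * b2 t], and [xu]
   makes [x] divide [b1 t]. *)
have E t : t \in C -> exists b', b1 t = x * b'.
  move=> tC; apply: (xu _ (b2 t)); apply/eqP; rewrite -subr_eq0; apply/eqP.
  move: t tC; apply: (indC (fun t => u * b1 t - x * b2 t)).
  rewrite (eq_bigr (fun t => f u * (f (b1 t) * c t) - f x * (f (b2 t) * c t))).
    by rewrite sumrB -!mulr_sumr -B1 -B2 -E1 -E2; ring.
  by move=> t _; rewrite rmorphB !rmorphM /=; ring.
have /boolp.choice[b' Eb'] : forall t, exists b', t \in C -> b1 t = x * b'.
  by move=> t; case: (boolP (t \in C)) => [/E[b']|_]; [exists b' | exists 0].
exists b'; apply: (mulfI fx0); rewrite mulrCA E1 B1 mulr_sumr.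
by apply: eq_bigr => t /Eb' ->; rewrite rmorphM mulrA.
Qed.

End ClearDenominators.

Lemma pihomog_coef (F : fieldType) n (G : {mpoly F[n]}) m : m \in msupp G ->
  (pihomog mdeg (mdeg m) G)@_m = G@_m.
Proof.
move=> mG; rewrite pihomogE big_mkcond raddf_sum /= (bigD1_seq m) ?msupp_uniq //=.
rewrite eqxx mcoeffZ mcoeffX eqxx mulr1 big1 ?addr0 // => m' /negPf ne.
by case: ifP => _; rewrite ?mcoeff0 // mcoeffZ mcoeffX ne mulr0.
Qed.

(** * A common denominator for functions with bounded poles *)

Section BoundedPoles.
Variables (F : finFieldType) (n : nat) (V W : projvar F n).
Variables (e r : nat) (y : 'I_r.+1 -> {mpoly F[n.+1]}).
Hypotheses (WV : vsub W V) (e0 : (0 < e)%N) (hy : hsop V e y).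
Hypothesis ind : forall G, ev y G \in hideal V -> G = 0.
Hypothesis yW : y ord0 \in hideal W.

Lemma psi_inj : injective (psi V y).
Proof.
move=> G H E; apply/eqP; rewrite -subr_eq0; apply/eqP/ind.
by rewrite rmorphB -tofr_eq0 rmorphB /= subr_eq0; apply/eqP.
Qed.

Lemma ev_integral p : exists2 chi : {poly {mpoly F[r.+1]}},
  chi \is monic & (map_poly (ev y) chi).[p] \in hideal V.
Proof.
have [b b0 hb] := finite_span e0 hy.
have [||chi mchi rchi] := @integral_of_span _ _ (psi V y) 'X_{1..n.+1 < b}
  (fun m => tofr V 'X_[m]) (tofr V p).
- have b00 : (mdeg (0%MM : 'X_{1..n.+1}) < b)%N by rewrite mdeg0.
  exists (BMultinom b00); rewrite /= mpolyX0 rmorph1; exact: oner_neq0.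
- move=> m; have [G EG] := hb (p * 'X_[m]); exists G.
  by rewrite -EG rmorphM.
exists chi => //; rewrite -tofr_eq0 -horner_map /= -map_poly_comp.
exact: rchi.
Qed.

Lemma not_X0free_mem G : ~~ X0free G -> ev y G \in hideal W.
Proof. by case/X0freePn => G' ->; rewrite rmorphM /= ev_X mulrC idealMr. Qed.

(* Incomparability: a point strictly inside W cannot meet A in (y_0) only. *)
Lemma incompar Q p : vsub Q W -> p \in hideal Q -> p \notin hideal W ->
  exists2 G, X0free G & ev y G \in hideal Q.
Proof.
move=> QW pQ pW; have [chi mchi /WV hchi] := ev_integral p.
(* Induction keeps the value at [p] in [hideal W] and some coefficient prime to [X_0], initially the
   leading 1. A constant coefficient prime to [X_0] is the desired [G], because [p] lies in
   [hideal Q]; any other vanishes on [W], and then a factor [p] can be cancelled. *)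
have : exists j, X0free chi`_j.
  by exists (size chi).-1; rewrite -lead_coefE (monicP mchi) X0free1.
elim/poly_ind: chi {mchi} hchi => [_ [j]|chi c IH hchi [j hj]].
  by rewrite coef0 /X0free msupp0.
move: hchi; rewrite rmorphD rmorphM /= map_polyX map_polyC /= hornerMXaddC => hchi.
case: (boolP (X0free c)) => [fc|nc].
  exists c => //; have := QW _ hchi.
  by rewrite rpredDl //; exact: idealMr.
have hchi' : (map_poly (ev y) chi).[p] \in hideal W.
  have := hchi; rewrite rpredDr ?not_X0free_mem // prime_idealrM.
  by rewrite (negPf pW) orbF.
apply: (IH hchi'); case: j hj => [|j hj].
  by rewrite -cons_poly_def coef_cons /= => fc; rewrite fc in nc.
by exists j; move: hj; rewrite -cons_poly_def coef_cons.
Qed.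

Lemma den_mul_hidl (h : funfield V) s k : s \is k.-homog ->
  hideal_pred (fun u => den h (u * s)).
Proof.
move=> hs; have hd := den_hidl h; split.
- by rewrite mul0r; exact: hidl0.
- by move=> u v du dv; rewrite mulrDl; exact: hidlD.
- by move=> u v dv; rewrite -mulrA; exact: hidlM.
- by move=> i u du; rewrite -(pihomogMr _ _ hs); exact: hidl_pi.
Qed.

(** Otherwise some prime contains every [v] with [v * y ord0 ^+ m] a denominator, but no [ev y G]
    for a form [G] prime to [X_0]. It is a point of [V], and regularity of [h] off [W] puts it on
    [W]; it contains the given [u], so it is strictly inside [W], against [incompar]. *)
Lemma den_X0free (h : funfield V) m : regular_off W h ->
  (exists2 u, u \notin hideal W & den h (u * y ord0 ^+ m)) ->
  exists2 G, X0free G & den h (ev y G * y ord0 ^+ m).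
Proof.
move=> reg [u nu du].
pose M p := exists G k, [/\ X0free G, G \is k.-homog & p = ev y G].
have hyh := hy.1.
have [i ni] := hy.2 W WV.
have hs : y ord0 ^+ m \is (e * m).-homog by apply: dhomogMn.
have J := den_mul_hidl h hs.
apply: contrapT => nG.
have [] := exists_projvar (M := M) J.
- by exists 1, 0%N; rewrite rmorph1 dhomog1; split=> //; exact: X0free1.
- move=> p q [G [k [fG hG ->]]] [H [l [fH hH ->]]]; exists (G * H), (k + l)%N.
  by rewrite rmorphM; split=> //; [exact: X0freeM | exact: dhomogM].
- by move=> p [G [k [_ hG ->]]]; exists (e * k)%N; exact: ev_hom.
(* A form of positive degree in [M]: [y i] is nonzero on [W], so [i] is not 0, as [y ord0] vanishes
   there. *)
- exists e, (y i); split=> //; exists 'X_i, 1%N; rewrite ev_X; split=> //.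
    apply/hasP; exists U_(i)%MM; first by rewrite msuppX inE.
    rewrite mnm1E; apply/negP => /negP; rewrite eqb0 negbK => /eqP E.
    by move: ni; rewrite E yW.
  exact: X_homog.
- by move=> p dp [G [k [fG _ Ep]]]; apply: nG; exists G; rewrite -?Ep.
move=> Q [JQ MQ].
have QV : vsub Q V.
  by move=> p pV; apply: JQ; apply: hidlMr; [exact: den_hidl | exact: den_ideal].
have QW : vsub Q W.
  apply: contrapT => nQW; have [v /negP nv dv] := den_locring QV (reg Q QV nQW).
  by apply: nv; apply: JQ; apply: hidlMr => //; exact: den_hidl.
have [G fG GQ] := incompar QW (JQ u du) nu.
(* [M] contains only forms, so [G] is replaced by a component that keeps a monomial free of
   [X_0]. *)
have [k fk] : exists k, X0free (pihomog mdeg k G).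
  case/hasP: fG => m0 m0G m00; exists (mdeg m0); apply/hasP; exists m0 => //.
  by rewrite mcoeff_msupp pihomog_coef // -mcoeff_msupp.
have /negP := MQ _ (ex_intro _ _ (ex_intro _ k (And3 fk (pihomogP _ _ _) erefl))).
by apply; exact: (ev_homog_mem k e0 hyh GQ).
Qed.

Lemma common_den m : exists2 D, D \notin hideal V & forall h : funfield V,
  regular_off W h -> (exists2 u, u \notin hideal W & den h (u * y ord0 ^+ m)) ->
  den h D.
Proof.
have [b b0 hb] := finite_span e0 hy.
pose c (t : 'X_{1..n.+1 < b}) := tofr V 'X_[t].
have [C [delta [indC d0 hC]]] := clear_denominators (psi V y) c.
have y0 : y ord0 \notin hideal V.
  apply/negP => yV; have := @ind 'X_ord0; rewrite ev_X => /(_ yV) /eqP.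
  by rewrite (negPf (X0_neq0 _ _)).
exists (ev y delta * y ord0 ^+ m).
  rewrite prime_idealrM negb_or; apply/andP; split.
    by apply: contra d0 => /ind ->.
  by rewrite -tofr_eq0 rmorphXn /= expf_neq0 // tofr_eq0.
move=> h reg hu; have [G fG [w Ew]] := den_X0free reg hu.
have [k [w' Ew']] := den_power reg e0 (hy.1 ord0) yW.
pose z := tofr V (y ord0 ^+ m) * ffval h.
have [||||a Ea] := @clear_coprime _ _ (psi V y) _ c psi_inj C delta
    ('X_ord0 ^+ k) G z indC hC.
- by rewrite expf_neq0 // X0_neq0.
- by move=> b1 c1; exact: X0free_dvd.
- have [a Ea] := hb (w' * y ord0 ^+ m); exists a; rewrite -Ea.
  change (psi V y ('X_ord0 ^+ k) * z = tofr V (w' * y ord0 ^+ m)).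
  have -> : psi V y ('X_ord0 ^+ k) = tofr V (y ord0 ^+ k).
    by rewrite -(ev_X y ord0) -(rmorphXn (ev y)).
  by rewrite /z mulrCA Ew' mulrC (rmorphM (tofr V)).
- have [a Ea] := hb w; exists a; rewrite -Ea -Ew /z mulrA.
  by rewrite (rmorphM (tofr V)).
exists (\sum_(t in C) ev y (a t) * 'X_[t]).
rewrite (rmorphM (tofr V)) -mulrA [LHS]Ea (rmorph_sum (tofr V)) /=.
by apply: eq_bigr => t _; rewrite (rmorphM (tofr V)).
Qed.

End BoundedPoles.

Section FiniteSpace.
Variables (F : finFieldType) (n : nat) (V : projvar F n).

(** [h] has degree 0, so beyond the degree of [D] the components of a numerator vanish on [V] and
    may be cut off. *)
Lemma den_numer (h : funfield V) D : den h D ->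
  exists2 w, (msize w <= msize D)%N & tofr V D * ffval h = tofr V w.
Proof.
move=> [w Ew]; have [e [p [q [hp hq nq E]]]] := ffvalP h.
exists (ptrunc (msize D) w); first exact: ptrunc_size.
apply/eqP; rewrite Ew -subr_eq0 -rmorphB /= tofr_eq0.
apply: contrapT => /(hidl_piN (ideal_hidl V))[k]; apply.
rewrite (raddfB (pihomog mdeg k)) /= pihomog_trunc; case: ltnP => kD.
  by rewrite subrr idealr0.
rewrite subr0; have Euw : D * p - w * q \in hideal V.
  rewrite -tofr_eq0 rmorphB !rmorphM /= -Ew E.
  by rewrite mulrA mulfVK ?subrr // tofr_neq0.
have := hideal_homog Euw (k + e).
rewrite (raddfB (pihomog mdeg (k + e))) /= !pihomogMr //.
rewrite (pihomog_ge kD) mul0r sub0r rpredN prime_idealrM (negPf nq) orbF.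
by [].
Qed.

Lemma den_finite D : D \notin hideal V ->
  exists s : seq (funfield V), forall h, den h D -> h \in s.
Proof.
move=> nD; pose T := 'X_{1..n.+1 < msize D}.
pose val_of (c : {ffun T -> F}) : crfrac V :=
  tofr V (\sum_(m : T) c m *: 'X_[m]) / tofr V D.
exists (pmap (fun c => insub (val_of c) : option (funfield V)) (enum {ffun T -> F})).
move=> h /den_numer[w sw Ew]; rewrite mem_pmap; apply/mapP.
exists [ffun m : T => w@_m]; first by rewrite mem_enum.
suff -> : val_of [ffun m : T => w@_m] = val h by rewrite valK.
rewrite /val_of; under eq_bigr => m _ do rewrite ffunE.
by rewrite -mpolywE // -Ew mulrC mulKf // tofr_neq0.
Qed.

End FiniteSpace.

(** * Divisors on a projective variety *)

Local Notation FF V := (Defs_funfield__canonical__GRing_Field V).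

Section Concrete.
Variables (F : finFieldType) (n : nat).
Implicit Types V W Q : projvar F n.

Lemma place_locring V W : vsub W V ->
  @place F (FF V) (FF W) (in_alg (funfield V)) (in_alg (funfield W))
    (@locring F n V W) (@restr F n V W).
Proof.
move=> WV; split.
- by move=> c; exact: locringC.
- by move=> f g; exact: locringD.
- by move=> f g; exact: locringM.
- by move=> f hf rf; exact: (locringV WV hf rf).1.
- by move=> g; exact: locring_lift.
- by move=> f; exact: ff_locfrac.
Qed.

Lemma locmaxE V W f : vsub W V ->
  @locmax F n V W f <-> pmax (@locring F n V W) (@restr F n V W) f.
Proof.
move=> WV; split=> [mf|[Of rf]]; last by apply/(locring_max WV).
by have Of := locmaxW mf; split=> //; apply/(locring_max WV).
Qed.

Lemma uniformizerE V W t : vsub W V ->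
  @uniformizer F n V W t <-> punif (@locring F n V W) (@restr F n V W) t.
Proof.
move=> WV; split=> -[mt ht].
  split; first exact/(locmaxE _ WV).
  by move=> f mf; apply: ht; apply/(locmaxE _ WV).
split; first exact/(locmaxE _ WV).
by move=> f mf; apply: ht; apply/(locmaxE _ WV).
Qed.

Lemma locunitE V W u : vsub W V ->
  @locunit F n V W u <-> locring W u /\ restr W u != 0.
Proof.
move=> WV; split=> -[Ou nu]; split=> //.
  by apply/eqP => ru; apply: nu; apply/(locring_max WV).
by move/(locring_max WV Ou)/eqP; apply/negP.
Qed.

Section Divisor.
Variables (V W : projvar F n) (r : nat).
Hypotheses (WV : vsub W V) (dV : vdim V r.+1) (dW : vdim W r).

Lemma uniformizer_neq0 t : uniformizer W t -> t != 0 :> funfield V.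
Proof.
move=> /(uniformizerE _ WV) ut.
exact: (punif_neq0 (place_locring WV) ut dV.1 dW.2).
Qed.

(** Every nonzero [f] has a decomposition, so for it the default value of [ord] is never taken. *)
Lemma ord_dvr : (exists t : funfield V, uniformizer W t) ->
  @dvr F (FF V) (FF W) (in_alg (funfield V)) (in_alg (funfield W)) (@locring F n V W)
    (@restr F n V W) (@ord F n V W).
Proof.
move=> [t ut]; have t0 := uniformizer_neq0 ut.
have ut' := (uniformizerE t WV).1 ut; have pl := place_locring WV.
apply: (dvr_of_punif pl t0 ut') => f f0.
rewrite /ord; case: classical_sets.xgetP => [k _ [t1 [u [ut1 uu E]]]|].
  have [Ou ru] := (locunitE _ WV).1 uu.
  by exists t1, u; split=> //; exact/(uniformizerE _ WV).
have [k [u [Ou ru E]]] := punif_ord pl ut' dV.1 dV.2 dW.1 dW.2 f0.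
by move/(_ k); case; exists t, u; split=> //; exact/(locunitE _ WV).
Qed.

(** The default value of [ord] is 0, so order 1 comes from a genuine decomposition, which supplies a
    uniformizer. *)
Lemma ord_eq1 g : ord W g = 1 ->
  g != 0 :> funfield V /\ exists t : funfield V, uniformizer W t.
Proof.
rewrite /ord; case: classical_sets.xgetP => // k Ek [t [u [ut uu E]]] k1.
split; last by exists t.
have [Ou ru] := (locunitE _ WV).1 uu.
rewrite E; apply: mulf_neq0; last exact: expfz_neq0 (uniformizer_neq0 ut).
have h := pl_neq0 (place_locring WV) ru; exact h.
Qed.

End Divisor.

Lemma const_of_dim0 V : vdim V 0 -> const_field V ->
  forall z : funfield V, exists c, z = c%:A.
Proof.
move=> [_ h0] hc z; apply: hc.
have [p [Ep p0]] : exists p : {mpoly F[1]},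
    mmap (in_alg (funfield V)) (fun _ => z) p = 0 /\ p != 0.
  apply: contrapT => h; apply: (h0 (fun _ => z)) => p Ep; apply/eqP.
  by case: eqVneq => // p0; case: h; exists p.
(* The coefficients of [muni p] are polynomials in no variables, that is constants, so [p] amounts
   to an ordinary polynomial over [F]. *)
pose P := map_poly (mcoeff 0%MM) (muni p).
have cst (q : {mpoly F[0]}) : q = (q@_0%MM)%:MP by exact: nvar0_mpolyC.
have EP : muni p = map_poly (@mpolyC 0 F) P.
  by apply/polyP => i; rewrite /P !coef_map /= -cst.
exists P.
  apply: contra p0 => /eqP P0; apply/eqP; apply: muni_inj.
  by rewrite EP P0 rmorph0.
rewrite /root; move: Ep; rewrite mmap_muni EP -map_poly_comp /= => <-.
rewrite -subr_eq0; apply/eqP; rewrite -[RHS](subrr (map_poly (in_alg (funfield V)) P).[z]).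
congr (_ - _.[_]); apply/polyP => i; rewrite !coef_map /=.
by rewrite mmapC.
Qed.

End Concrete.

Lemma clear_quotients (L : fieldType) (f w u s l : L) m : u != 0 -> l != 0 ->
  f * (s / l) ^+ m = w / u -> u * s ^+ m * f = w * l ^+ m.
Proof.
move=> nu nl E; have -> : w = f * (s / l) ^+ m * u by rewrite E divfK.
rewrite expr_div_n; have nlm := expf_neq0 m nl.
by move: (l ^+ m) nlm => lm nlm; field.
Qed.

(** * The spaces L(mW) and the ring R *)

Section FunctionsWithPoles.
Variables (F : finFieldType) (n : nat) (V W : projvar F n).
Hypothesis WV : vsub W V.
Hypothesis dv : @dvr F (FF V) (FF W) (in_alg (funfield V)) (in_alg (funfield W))
    (@locring F n V W) (@restr F n V W) (@ord F n V W).

Lemma ordM (f g : funfield V) : f != 0 -> g != 0 -> ord W (f * g) = ord W f + ord W g.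
Proof. exact (@dvrM _ _ _ _ _ _ _ _ dv f g). Qed.

Lemma ord_ge0 (f : funfield V) : f != 0 -> 0 <= ord W f <-> locring W f.
Proof. exact (@dvr_ge0 _ _ _ _ _ _ _ _ dv f). Qed.

Lemma ord_gt0 (f : funfield V) : f != 0 -> locmax W f -> 0 < ord W f.
Proof.
move=> f0 /(locmaxE _ WV)[Of rf]; exact (@dvr_gt0 _ _ _ _ _ _ _ _ dv f f0 Of rf).
Qed.

Lemma ord1 : ord W (1 : funfield V) = 0.
Proof. exact (dvr1 dv). Qed.

Lemma ordX (f : funfield V) k : f != 0 -> ord W (f ^+ k) = ord W f * k%:Z.
Proof. exact (@dvrZ _ _ _ _ _ _ _ _ dv f k). Qed.

Lemma ordD (f g : funfield V) m : f != 0 -> g != 0 -> f + g != 0 ->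
  m <= ord W f -> m <= ord W g -> m <= ord W (f + g).
Proof. exact (@dvrD _ _ _ _ _ _ _ _ dv f g m). Qed.

Lemma ord_const (c : F) : c != 0 -> ord W (c%:A : funfield V) = 0.
Proof.
move=> c0; have A0 : (c%:A : funfield V) != 0.
  by rewrite scaler_eq0 negb_or c0 oner_neq0.
apply: (dvr_eq0 dv A0).2; have [h1 h2] := locringC WV c; split; first exact h1.
rewrite h2; have h : (c%:A : funfield W) != 0 by rewrite scaler_eq0 negb_or c0 oner_neq0.
exact h.
Qed.

Lemma reg1 : regular_off W (1 : funfield V).
Proof.
move=> Q QV _; have := (locringC QV 1).1; by rewrite scale1r.
Qed.

Lemma regM (f g : funfield V) : regular_off W f -> regular_off W g -> regular_off W (f * g).
Proof. by move=> hf hg Q QV nQ; exact: (locringM QV (hf Q QV nQ) (hg Q QV nQ)).1. Qed.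

Lemma regD (f g : funfield V) : regular_off W f -> regular_off W g -> regular_off W (f + g).
Proof. by move=> hf hg Q QV nQ; exact: (locringD QV (hf Q QV nQ) (hg Q QV nQ)).1. Qed.

Lemma regZ c (f : funfield V) : regular_off W f -> regular_off W (c *: f).
Proof.
move=> hf Q QV nQ; rewrite -[f]mul1r scalerAl.
exact: (locringM QV (locringC QV c).1 (hf Q QV nQ)).1.
Qed.

Lemma ordZ c (f : funfield V) : c != 0 -> f != 0 -> ord W (c *: f) = ord W f.
Proof.
move=> c0 f0; have E : c *: f = c%:A * f by rewrite -scalerAl mul1r.
have A0 : (c%:A : funfield V) != 0 by rewrite scaler_eq0 negb_or c0 oner_neq0.
by rewrite E (ordM A0 f0) (ord_const c0) add0r.
Qed.

Lemma Lspace_le m m' (f : funfield V) : (m <= m')%N -> Lspace W m f -> Lspace W m' f.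
Proof.
move=> mm [->|[hf rf]]; [by left | right; split=> //].
by apply: le_trans hf; rewrite lerN2 lez_nat.
Qed.

Lemma Lspace_lin m c (f g : funfield V) :
  Lspace W m f -> Lspace W m g -> Lspace W m (c *: f + g).
Proof.
move=> hf hg; case: (eqVneq (c *: f + g) 0) => [->|n0]; first by left.
case: (eqVneq (c *: f) 0) => [cf0|cf0]; first by rewrite cf0 add0r.
have [c0 f0] : c != 0 /\ f != 0.
  by move: cf0; rewrite scaler_eq0 negb_or => /andP.
case: hf => [f0'|[of_ rf]]; first by rewrite f0' eqxx in f0.
case: (eqVneq g 0) => [g0|g0].
  by right; rewrite g0 addr0 ordZ //; split=> //; exact: regZ.
case: hg => [g0'|[og rg]]; first by rewrite g0' eqxx in g0.
right; split; last by apply: regD => //; exact: regZ.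
have h1 : - m%:Z <= ord W (c *: f) by rewrite (ordZ c0 f0).
exact (ordD cf0 g0 n0 h1 og).
Qed.

Lemma Lspace_mul m m' (f g : funfield V) :
  Lspace W m f -> Lspace W m' g -> Lspace W (m + m') (f * g).
Proof.
case=> [->|[of_ rf]]; first by rewrite mul0r; left.
case=> [->|[og rg]]; first by rewrite mulr0; left.
case: (eqVneq f 0) => [->|f0]; first by rewrite mul0r; left.
case: (eqVneq g 0) => [->|g0]; first by rewrite mulr0; left.
right; split; last exact: regM.
by rewrite (ordM f0 g0) PoszD opprD; apply: lerD.
Qed.

Lemma Lring1 : Lring W (1 : funfield V).
Proof. by exists 0%N; right; rewrite ord1; split=> //; exact: reg1. Qed.

Lemma Lring_lin c (f g : funfield V) : Lring W f -> Lring W g -> Lring W (c *: f + g).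
Proof.
move=> [m hf] [m' hg]; exists (maxn m m'); apply: Lspace_lin.
  exact: Lspace_le (leq_maxl _ _) hf.
exact: Lspace_le (leq_maxr _ _) hg.
Qed.

Lemma Lring_mul (f g : funfield V) : Lring W f -> Lring W g -> Lring W (f * g).
Proof. by move=> [m hf] [m' hg]; exists (m + m')%N; exact: Lspace_mul. Qed.

Hypothesis hmax : exists2 t : funfield V, t != 0 & locmax W t.

Lemma ideal_element : exists e s, [/\ (0 < e)%N, s \is e.-homog, s \in hideal W &
  s \notin hideal V].
Proof.
have [t t0 [e [p [q [hp hq nq pW E]]]]] := hmax.
(* The factor ['X_i] makes the degree positive. *)
have [i ni] := hideal_relevant V; exists e.+1, (p * 'X_i); split=> //.
- by have := dhomogM hp (X_homog F i); rewrite addn1.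
- by rewrite mulrC idealMr.
rewrite prime_idealrM negb_or ni andbT.
apply: contra t0; rewrite -tofr_eq0 -ffval_eq0 E => /eqP ->.
by rewrite mul0r.
Qed.

(** For a form [l] of the same degree, nonzero on [W], the quotient [s / l] has order at least 1, so
    its [m]-th power cancels the pole of [f] along [W]. *)
Lemma Lspace_den e s m (f : funfield V) : s \is e.-homog -> s \in hideal W ->
  s \notin hideal V -> f != 0 -> Lspace W m f ->
  exists2 u, u \notin hideal W & den f (u * s ^+ m).
Proof.
move=> hs sW sV f0 [f0'|[of_ rf]]; first by rewrite f0' eqxx in f0.
have [l nl hl] := homog_notin W e.
have [a Ea] := mkff hs hl (notin_vsub WV nl).
have a0 : a != 0.
  by rewrite -ffval_eq0 Ea mulf_eq0 invr_eq0 !tofr_eq0 negb_or sV (notin_vsub WV nl).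
have ma : locmax W a by exists e, s, l; split.
have oa := ord_gt0 a0 ma.
have am0 : a ^+ m != 0 := expf_neq0 m a0.
have fa0 : f * a ^+ m != 0 := mulf_neq0 f0 am0.
have : locring W (f * a ^+ m).
  apply/(ord_ge0 fa0); rewrite (ordM f0 am0) (ordX m a0).
  have : ord W f + m%:Z <= ord W f + ord W a * m%:Z.
    by rewrite lerD2l -[X in X <= _]mul1r ler_wpM2r // gtz0_ge1.
  by apply: le_trans; rewrite -lerBlDr sub0r.
move=> [k [w [u [hw hu nu E]]]]; exists u => //; exists (w * l ^+ m).
have nu' := tofr_neq0 (notin_vsub WV nu); have nl' := tofr_neq0 (notin_vsub WV nl).
move: E; rewrite ffvalM ffvalX Ea => E.
rewrite !(rmorphM (tofr V)) !(rmorphXn (tofr V)).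
exact (clear_quotients nu' nl' E).
Qed.

Lemma Lspace_finite m : exists s : seq (funfield V), forall f, Lspace W m f -> f \in s.
Proof.
have [e [s [e0 hs sW sV]]] := ideal_element.
have [r [e' [y [c [e'0 c0 hy Ey ind]]]]] := noether_norm e0 hs sV.
have yW : y ord0 \in hideal W.
  by rewrite Ey -(prednK c0) exprSr idealMr.
have yV : y ord0 \notin hideal V.
  by rewrite Ey -tofr_eq0 rmorphXn /= expf_neq0 // tofr_eq0.
have [D nD hD] := common_den WV e'0 hy ind yW m.
have [l hl] := den_finite nD; exists (0 :: l) => f Lf; rewrite inE.
case: (eqVneq f 0) => //= f0; apply: hl; apply: hD.
  by case: Lf => [f0'|[_ //]]; rewrite f0' eqxx in f0.
exact: Lspace_den (hy.1 ord0) yW yV f0 Lf.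
Qed.

Lemma Lring_ord_ge0 (f : funfield V) : const_field V -> Lring W f -> f != 0 ->
  0 <= ord W f -> exists c, f = c%:A.
Proof.
move=> hc [m [f0'|[_ rf]]] f0 of_; first by rewrite f0' eqxx in f0.
apply: hc; have [s hs] := Lspace_finite 0.
have fX k : f ^+ k \in s.
  apply: hs; right; rewrite (ordX k f0); split; first by rewrite mulr_ge0.
  elim: k => [|k IH]; first by rewrite expr0; exact: reg1.
  by rewrite exprS; exact: regM.
(* All powers of [f] lie in the finite set L(0), so two coincide and [f] is a root of some
   ['X^b - 'X^a]. *)
have : ~~ uniq [seq f ^+ k | k <- iota 0 (size s).+1].
  apply/negP => u; have := uniq_leq_size u; rewrite size_map size_iota => h.
  have : ((size s).+1 <= size s)%N by apply: h => _ /mapP[k _ ->].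
  by rewrite ltnn.
move/uniqPn => /(_ 0)[a [b [ab]]]; rewrite size_map size_iota => bs.
rewrite !(nth_map 0%N) ?size_iota // 1?(ltn_trans ab) //.
rewrite !nth_iota // 1?(ltn_trans ab) // !add0n => E.
exists ('X^b - 'X^a).
  rewrite -size_poly_eq0 size_polyDl ?size_polyN ?size_polyXn //.
rewrite /root rmorphB /= !map_polyXn hornerD hornerN !hornerXn E subrr.
exact: eqxx.
Qed.

End FunctionsWithPoles.

(** * Order functions *)

Section LexRows.
Variable d : nat.
Implicit Types a b c : 'rV[int]_d.

Lemma lexltP a b : reflect
  (exists2 k : 'I_d, forall i : 'I_d, (i < k)%N -> a 0 i = b 0 i & a 0 k < b 0 k)
  (lexlt a b).
Proof.
rewrite /lexlt; apply: (iffP ltxi_tuplePlt) => -[k h1 h2]; exists k.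
- by move=> i /h1; rewrite !tnth_mktuple.
- by move: h2; rewrite !tnth_mktuple.
- by move=> i /h1; rewrite !tnth_mktuple.
- by rewrite !tnth_mktuple.
Qed.

Lemma lexlt_irr a : ~~ lexlt a a.
Proof. by rewrite /lexlt ltxx. Qed.

Lemma lexlt_trans a b c : lexlt a b -> lexlt b c -> lexlt a c.
Proof. by rewrite /lexlt; exact: lt_trans. Qed.

Lemma lexlt_total a b : [\/ lexlt a b, a = b | lexlt b a].
Proof.
rewrite /lexlt; case: ltgtP => [h|h|E]; [by constructor 1|by constructor 3|].
constructor 2; apply/rowP => i.
by have := congr1 (fun t => tnth t i) E; rewrite !tnth_mktuple.
Qed.

Lemma lexlt_addl a b c : lexlt a b -> lexlt (a + c) (b + c).
Proof.
move=> /lexltP[k h1 h2]; apply/lexltP; exists k => [i /h1 E|].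
  by rewrite !mxE E.
by rewrite !mxE ltrD2r.
Qed.

Lemma lexlt_min_seq (s : seq 'rV[int]_d) (S : 'rV[int]_d -> Prop) :
  (exists2 a, S a & a \in s) ->
  exists2 m, S m & forall a, S a -> a \in s -> a = m \/ lexlt m a.
Proof.
elim: s => [[a _]|b s IH [a Sa]]; first by rewrite in_nil.
rewrite inE => ha; case: (pselect (exists2 a, S a & a \in s)) => [/IH[m Sm hm]|h].
  case: (pselect (S b)) => [Sb|nSb]; last first.
    exists m => // a' Sa'; rewrite inE => /predU1P[E|]; last exact: hm.
    by rewrite E in Sa'.
  have [bm|bm|mb] := lexlt_total b m.
  - exists b => // a' Sa'; rewrite inE => /predU1P[->|/(hm _ Sa')]; first by left.
    by case=> [->|ma]; right=> //; exact: lexlt_trans bm ma.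
  - exists m => // a' Sa'; rewrite inE => /predU1P[->|/(hm _ Sa')//].
    by left.
  - exists m => // a' Sa'; rewrite inE => /predU1P[->|/(hm _ Sa')//].
    by right.
have Sb : S b by case/predU1P: ha => [<-//|as_]; case: h; exists a.
exists b => // a' Sa'; rewrite inE => /predU1P[->|as_]; first by left.
by case: h; exists a'.
Qed.

End LexRows.

(** * From a valuation to an order function *)

Section OrderFromValuation.
Variables (F : finFieldType) (A : comAlgType F) (R : A -> Prop) (d : nat).
Variable v : A -> nat -> int.
Hypotheses (d0 : (0 < d)%N) (R1 : R 1)
  (Rlin : forall c f g, R f -> R g -> R (c *: f + g))
  (Rmul : forall f g, R f -> R g -> R (f * g))
  (mulA : forall f g : A, f != 0 -> g != 0 -> f * g != 0)
  (vM : forall f g j, f != 0 -> g != 0 -> (j < d)%N -> v (f * g) j = v f j + v g j)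
  (vZ : forall c f j, c != 0 -> f != 0 -> (j < d)%N -> v (c *: f) j = v f j).
Let vlt f g := lexlt_seq d (v f) (v g).
Let veq f g := forall j, (j < d)%N -> v f j = v g j.
Hypotheses
  (v_total : forall f g, f != 0 -> g != 0 -> (vlt f g \/ veq f g) \/ vlt g f)
  (v_add : forall f g, f != 0 -> g != 0 -> f + g != 0 ->
     vlt f g \/ veq f g -> vlt f (f + g) \/ veq f (f + g))
  (v_sub : forall f g, f != 0 -> g != 0 -> veq f g ->
     exists2 c, c != 0 & f - c *: g != 0 -> vlt f (f - c *: g))
  (v_neg : forall f, R f -> f != 0 -> v f 0 <= 0)
  (v_fin : forall m : nat, exists s : seq A,
     forall f, R f -> f != 0 -> - m%:Z <= v f 0 -> f \in s).

Let w f : 'rV[int]_d := - \row_(i < d) v f i.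
Let rho f : option 'rV[int]_d := if f == 0 then None else Some (w f).
Let G a := exists f, [/\ R f, f <> 0 & rho f = Some a].

Lemma lexlt_w f g : lexlt (w f) (w g) <-> vlt g f.
Proof.
split=> [/lexltP[k h1 h2]|[k kd [h1 h2]]].
  exists k => //; split=> [j jk|].
    have jd := ltn_trans jk (ltn_ord k).
    by have := h1 (Ordinal jd) jk; rewrite !mxE => /oppr_inj.
  by move: h2; rewrite !mxE ltrN2.
apply/lexltP; exists (Ordinal kd) => [i ik|]; last by rewrite !mxE ltrN2.
by rewrite !mxE h1.
Qed.

Lemma w_eq f g : w f = w g <-> veq f g.
Proof.
split=> [/rowP E j jd|E]; first by have := E (Ordinal jd); rewrite !mxE => /oppr_inj.
by apply/rowP => i; rewrite !mxE E.
Qed.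

Lemma rhoE f : f != 0 -> rho f = Some (w f).
Proof. by rewrite /rho => /negPf ->. Qed.

Lemma rho0 : rho 0 = None.
Proof. by rewrite /rho eqxx. Qed.

Lemma rhoM f g : rho (f * g) = oplus (rho f) (rho g).
Proof.
case: (eqVneq f 0) => [->|f0]; first by rewrite mul0r rho0.
case: (eqVneq g 0) => [->|g0]; first by rewrite mulr0 rho0; case: (rho f).
rewrite !rhoE ?mulA //=; congr Some; apply/rowP => i.
by rewrite !mxE vM // opprD.
Qed.

Lemma valued_wo : wo_semigroup G (@lexlt d).
Proof.
split.
- move=> a b [f [Rf f0 Ef]] [g [Rg g0 Eg]]; exists (f * g).
  split; [exact: Rmul | | by rewrite rhoM Ef Eg].
  by apply/eqP/mulA; apply/eqP.
- by move=> a _; exact: lexlt_irr.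
- by move=> a b c _ _ _; exact: lexlt_trans.
- by move=> a b _ _; exact: lexlt_total.
- move=> S SG [a0 Sa0]; pose i0 := Ordinal d0.
  have Sf a : S a -> exists f, [/\ R f, f != 0, a = w f & exists m : nat, a 0 i0 = m%:Z].
    move=> /SG[f [Rf f0 Ef]]; exists f; have {}f0 : f != 0 by apply/eqP.
    move: Ef; rewrite rhoE // => -[Ea]; split=> //.
    have := v_neg Rf f0; rewrite -Ea !mxE /= -oppr_ge0.
    by case: (- v f 0) => m // _; exists m.
  have ex : exists m : nat, `[< exists2 a, S a & a 0 i0 = m%:Z >].
    have [f [_ _ _ [m Em]]] := Sf a0 Sa0; exists m; apply/asboolP.
    by exists a0.
  (* The first coordinate is minimized first; [v_fin] leaves finitely many values with that
     minimum. *)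
  case: (ex_minnP ex) => m /asboolP[a1 Sa1 Ea1] mmin.
  have [s hs] := v_fin m.
  have Ss a : S a -> a 0 i0 = m%:Z -> a \in map w s.
    move=> Sa Ea; have [f [Rf f0 Ew _]] := Sf a Sa.
    rewrite Ew; apply/map_f/hs => //.
    by rewrite -Ea Ew !mxE /= opprK.
  have [b [Sb Eb] hb] := @lexlt_min_seq d (map w s) (fun a => S a /\ a 0 i0 = m%:Z)
    (ex_intro2 _ _ a1 (conj Sa1 Ea1) (Ss _ Sa1 Ea1)).
  exists b => // a Sa; have [f [_ _ _ [m' Em']]] := Sf a Sa.
  have mm' : (m <= m')%N by apply: mmin; apply/asboolP; exists a.
  move: mm'; rewrite leq_eqVlt => /predU1P[E|lt_m].
    by apply: hb; rewrite ?Ss // ?E.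
  by right; apply/lexltP; exists i0 => //; rewrite Eb Em' ltz_nat.
- by move=> a b c _ _ _; exact: lexlt_addl.
Qed.

(** [w] reverses the order of [v], so the smaller value of [v] gives the maximum. *)
Lemma omaxC_le f g : vlt f g \/ veq f g ->
  omax (@lexlt d) (Some (w f)) (Some (w g)) = Some (w f) /\
  omax (@lexlt d) (Some (w g)) (Some (w f)) = Some (w f).
Proof.
rewrite /omax /=; case=> [/lexlt_w h|/w_eq ->]; last by rewrite (negPf (lexlt_irr _)).
rewrite h; case: ifP => // h'.
by have := lexlt_trans h h'; rewrite (negPf (lexlt_irr _)).
Qed.

Lemma rho_add f g : rho (f + g) = omax (@lexlt d) (rho f) (rho g) \/
  olt (@lexlt d) (rho (f + g)) (omax (@lexlt d) (rho f) (rho g)).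
Proof.
case: (eqVneq f 0) => [->|f0].
  by left; rewrite add0r rho0 /omax; case: (rho g).
case: (eqVneq g 0) => [->|g0].
  by left; rewrite addr0 rho0 /omax; case: (rho f).
have key f1 g1 : f1 != 0 -> g1 != 0 -> vlt f1 g1 \/ veq f1 g1 ->
    rho (f1 + g1) = Some (w f1) \/ olt (@lexlt d) (rho (f1 + g1)) (Some (w f1)).
  move=> f10 g10 h; case: (eqVneq (f1 + g1) 0) => [->|fg0]; first by rewrite rho0; right.
  rewrite rhoE //; case: (v_add f10 g10 fg0 h) => [/lexlt_w h'|/w_eq ->]; last by left.
  by right.
rewrite (rhoE f0) (rhoE g0); case: (v_total f0 g0) => [h|h].
  by rewrite (omaxC_le h).1; exact: key.
by rewrite addrC (omaxC_le (or_introl h)).2; apply: key => //; left.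
Qed.

Lemma order_function_of_valuation : order_function R G (@lexlt d) rho.
Proof.
split=> //.
- exact: valued_wo.
- by move=> f Rf a Ea; exists f; split=> // f0; move: Ea; rewrite f0 rho0.
- by move=> a [f [Rf _ Ef]]; exists f.
- exists 0; last exact: rho0.
  by have := Rlin (-1) R1 R1; rewrite scaleN1r addNr.
- by move=> f _; rewrite /rho; case: eqP => // f0; split.
- move=> f c _ c0; case: (eqVneq f 0) => [->|f0]; first by rewrite scaler0.
  have cf0 : c *: f != 0.
    apply: contra f0 => /eqP E; rewrite -[f]scale1r -(mulVf c0) -scalerA E.
    by rewrite scaler0.
  by rewrite !rhoE //; congr Some; apply/w_eq => j jd; rewrite vZ.
- by move=> f g _ _; exact: rho_add.
- move=> f g _ _; case: (eqVneq f 0) => [->|f0]; first by rewrite rho0.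
  case: (eqVneq g 0) => [->|g0]; first by rewrite rho0.
  rewrite !rhoE // => -[/w_eq E] _; have [c c0 hc] := v_sub f0 g0 E.
  exists c => //; case: (eqVneq (f - c *: g) 0) => [->|n0]; first by rewrite rho0.
  by rewrite rhoE //=; apply/lexlt_w/hc.
- by move=> f g _ _; exact: rhoM.
Qed.

End OrderFromValuation.

Theorem theorem3 (F : finFieldType) (n d : nat) (V : nat -> projvar F n)
    (g : nat -> funfield (V 0%N)) :
  (0 < d)%N ->
  is_flag d V ->
  ample (V 0%N) (V 1%N) ->
  flag_equations d g ->
  order_function (Lring (V 1%N))
    (fun a : 'rV[int]_d =>
       exists f, [/\ Lring (V 1%N) f, f <> 0 & flag_rho g d f = Some a])
    (@lexlt d)
    (flag_rho g d).
Proof.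
move=> d0 [sub dim _ cst _] _ hg.
have dimS i : (i < d)%N -> vdim (V i) (d - i.+1).+1.
  by move=> id; rewrite subnSK //; apply: dim; exact: ltnW.
pose K i := FF (V i).
have e1 i (id : (i < d)%N) := ord_eq1 (sub i id) (dimS i id) (dim i.+1 id) (hg i id).2.
have dv i : (i < d)%N -> @dvr F (K i) (K i.+1) (in_alg (funfield (V i)))
    (in_alg (funfield (V i.+1))) (@locring F n (V i) (V i.+1))
    (@restr F n (V i) (V i.+1)) (@ord F n (V i) (V i.+1)).
  by move=> id; exact (ord_dvr (sub i id) (dimS i id) (dim i.+1 id) (e1 i id).2).
have lc : forall z : K d, exists c, z = in_alg (funfield (V d)) c.
  apply: const_of_dim0; last exact: cst.
  by have := dim d (leqnn d); rewrite subnn.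
pose res i := @restr F n (V i) (V i.+1); pose ordi i := @ord F n (V i) (V i.+1).
(* [rable], [rto] and [oat] are convertible to [restrictable], [restr_to] and [ord_at] for this
   flag. *)
have hg' i : (i < d)%N -> [/\ rable (K := K) (fun i => @locring F n (V i) (V i.+1)) res i (g i),
    rto (K := K) res i (g i) != 0 & oat (K := K) res ordi i (g i) = 1].
  move=> id; split; [exact (hg i id).1 | exact (e1 i id).1 | exact (hg i id).2].
pose v := fval (K := K) res ordi g.
have WV := sub 0%N d0.
have dv0 := dv 0%N d0.
have hmax : exists2 t : funfield (V 0%N), t != 0 & locmax (V 1%N) t.
  have [_ [t ut]] := e1 0%N d0; exists t; last exact: ut.1.
  exact: uniformizer_neq0 WV (dimS 0%N d0) (dim 1%N d0) _ ut.
have const_n0 c : c != 0 -> (c%:A : funfield (V 0%N)) != 0.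
  by move=> c0; rewrite scaler_eq0 negb_or c0 oner_neq0.
have scaleE c (f : funfield (V 0%N)) : c *: f = c%:A * f by rewrite -scalerAl mul1r.
apply: (@order_function_of_valuation F (funfield (V 0%N)) (Lring (V 1%N)) d v d0).
- exact (Lring1 dv0).
- by move=> c f h; exact (@Lring_lin F n (V 0%N) (V 1%N) WV dv0 c f h).
- by move=> f h; exact (@Lring_mul F n (V 0%N) (V 1%N) dv0 f h).
- by move=> f h f0 h0; exact (mulf_neq0 f0 h0).
- by move=> f h j; exact (@fvalM _ _ _ _ _ _ _ dv g hg' f h j).
- move=> c f j c0 f0 jd; rewrite scaleE.
  have E1 := @fvalM _ _ _ _ _ _ _ dv g hg' _ f j (const_n0 c c0) f0 jd.
  have E2 := @fval_const _ _ _ _ _ _ _ dv g hg' c j c0 jd.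
  by rewrite -/v in E1 E2; rewrite [LHS]E1 [X in X + _]E2 add0r.
- by move=> f h; exact (@fle_total d K res ordi g f h).
- by move=> f h; exact (@fval_add _ _ _ _ _ _ _ dv g hg' f h).
- move=> f h f0 h0 E.
  have [c c0 hc] := @fval_sub _ _ _ _ _ _ _ dv lc g hg' f h f0 h0 E.
  exists c; first exact c0. rewrite (scaleE c h); exact hc.
(* A positive order along [V 1] would make [f] a constant, whose order is 0. *)
- move=> f Rf f0; rewrite leNgt; apply/negP => of0.
  have [c Ec] := Lring_ord_ge0 WV dv0 hmax (cst 0%N (leq0n d)) Rf f0 (ltW of0).
  have c0 : c != 0 by apply: contra f0 => /eqP c0; rewrite Ec c0 scale0r.
  move: of0; rewrite /v /fval /oat /= /ordi Ec (ord_const WV dv0 c0).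
  by rewrite ltxx.
(* Regularity off [V 1] does not involve the level [m'], so the bound on the order places [f] in the
   space of level [m]. *)
- move=> m; have [s hs] := Lspace_finite WV dv0 hmax m; exists s => f [m' Lf] f0 of0.
  apply: hs; right; split; first exact: of0.
  by case: Lf => [f0'|[_ rf]] //; rewrite f0' eqxx in f0.
Qed.
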